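(* Let $\mathcal{O}$ be an unpunctured orbifold of arbitrary genus whose boundary has exactly one marked point, and let $\mathcal{A}(\mathcal{O})$ be the cluster algebra with principal coefficients associated to $\mathcal{O}$. Then the Laurent polynomial associated to the essential loop around the boundary of $\mathcal{O}$ belongs to $\mathcal{A}(\mathcal{O})$.
   Context: An orbifold here is a connected oriented surface with non-empty boundary, a finite set of marked points on the boundary (here exactly one, hence a single boundary component), no punctures (no interior marked points), and finitely many orbifold points of weight $1/2$ in the interior. Triangulations may contain pending arcs, i.e. arcs joining a marked point to an orbifold point. The associated cluster algebra $\mathcal{A}(\mathcal{O})$ is the (generally skew-symmetrizable) cluster algebra of Felikson–Shapiro–Tumarkin whose cluster variables correspond to arcs and whose clusters correspond to triangulations; it is taken with principal coefficients $y_1,\dots,y_n$ at an initial triangulation (coefficients not assumed invertible). To every arc and every closed curve $\gamma$ one associates a Laurent polynomial in the initial cluster variables with coefficients in $\mathbb{Z}[y_1,\dots,y_n]$, obtained from the Musiker–Schiffler–Williams perfect-matching (snake graph / band graph) expansion formula applied to a suitable lift of $\gamma$ in an unfolding of $\mathcal{O}$ (a branched cover that is a surface), followed by specialization of variables. The essential loop around the boundary is the simple closed curve in the interior of $\mathcal{O}$ homotopic to the boundary component. *)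

(* Defs.v *)
From HB Require Import structures.
From mathcomp Require Import all_boot all_order all_algebra.
From mathcomp Require Import finmap.
From mathcomp Require Import mpoly.

Set Implicit Arguments.
Unset Strict Implicit.
Unset Printing Implicit Defensive.

Import Order.TTheory GRing.Theory Num.Theory.
Local Open Scope ring_scope.

(* An orbifold with orbifold points of weight 1/2, given together with a
   triangulation, is encoded by the sides of the triangles.  [ccw h] is the
   side following h counterclockwise in its triangle.  [opp] glues the sides
   (reversing their direction, so the surface is oriented):
   - a boundary side is unglued, and fixed by [opp] by convention;
   - two distinct sides exchanged by [opp] form an ordinary arc;
   - a non-boundary side fixed by [opp] is folded onto itself about its
     midpoint, which is then an orbifold point (cone angle pi): the folded side
     is a pending arc, going from its marked endpoint to that orbifold point. *)
Record orbifold := Orbifold {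
  side :> finType;
  ccw : side -> side;
  opp : side -> side;
  bdry : {set side};
  ccw_neq : forall h, ccw h != h;
  ccw3 : forall h, ccw (ccw (ccw h)) = h;
  oppK : involutive opp;
  opp_bdry : forall h, h \in bdry -> opp h = h;
  side_connected :
    forall h h', connect (fun u v => (v == ccw u) || (v == opp u)) h h';
  bdry_neq0 : bdry != set0
}.

(* [turn] rotates clockwise about the vertex at which a side (directed with its
   triangle on the left) ends, and jumps to the next boundary side when it
   reaches the boundary: its orbits are the boundary components and the interior
   marked points, according to whether they contain boundary sides. *)
Definition turn (O : orbifold) (h : O) : O := ccw (opp h).

Definition unpunctured (O : orbifold) : Prop :=
  forall h : O, exists2 b : O, b \in bdry O & fconnect (@turn O) h b.

(* Each boundary component has as many marked points as boundary segments, so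
   these are all the marked points of an unpunctured orbifold. *)
Definition nb_marked_points (O : orbifold) : nat := #|bdry O|.

Definition is_pending (O : orbifold) (h : O) : bool :=
  (h \notin bdry O) && (opp h == h).

(* A curve transverse to the triangulation is recorded by the sides through
   which it leaves the successive triangles; it never leaves a triangle through
   the side by which it has entered.  Crossing a pending arc (opp h = h) means
   passing to the other sheet of the local double cover branched at the
   orbifold point. *)
Definition crossing_step (O : orbifold) : rel O :=
  fun h h' => (h' == ccw (opp h)) || (h' == ccw (ccw (opp h))).

Definition is_closed_curve (O : orbifold) (w : seq O) : bool :=
  [&& w != [::], all (fun h => h \notin bdry O) w & cycle (@crossing_step O) w].

(* The simple closed curve parallel to the boundary component of the boundary
   side b: it starts in the triangle of b and, keeping the boundary on its right,
   crosses one after the other the ends of arcs at the marked points of this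
   component. *)
Definition boundary_loop (O : orbifold) (b : O) : seq O :=
  [seq h <- orbit (@turn O) b | h \notin bdry O].

(* Unfoldings: a finite cover by a surface, branched with index two at every
   preimage of every orbifold point, with the lifted triangulation.  Since no
   arc upstairs is pending, a pending arc is covered by ordinary arcs only.
   A map commuting with [ccw] and [opp] is a covering of the triangulated
   surfaces, as every triangle has exactly three sides. *)
Definition is_unfolding (S O : orbifold) (p : S -> O) : Prop :=
  [/\ forall h : S, ~~ is_pending h,
      forall h : S, p (ccw h) = ccw (p h),
      forall h : S, p (opp h) = opp (p h)
    & forall h : S, (p h \in bdry O) = (h \in bdry S)].

(* [w'] closes up after going once along [w]. *)
Definition is_closed_lift (S O : orbifold) (p : S -> O) (w : seq O)
    (w' : seq S) : Prop :=
  is_closed_curve w' /\ map p w' = w.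

(* Snake and band graphs.  Tiles are unit squares of the plane, with their
   diagonal from the north-west to the south-east corner.  An edge is given by
   its south-west endpoint, whether it is horizontal, and its label. *)
Section BandGraph.

Variable S : orbifold.

Definition point : Type := (nat * nat)%type.
Definition edge : Type := (point * bool * S)%type.

Definition edge_src (e : edge) : point := e.1.1.
Definition edge_tgt (e : edge) : point :=
  if e.1.2 then (e.1.1.1.+1, e.1.1.2) else (e.1.1.1, e.1.1.2.+1).
Definition edge_label (e : edge) : S := e.2.

Record tile := Tile { tileS : edge; tileE : edge; tileN : edge; tileW : edge }.

Definition tile_edges (t : tile) : {fset edge} :=
  [fset tileS t; tileE t; tileN t; tileW t]%fset.

(* The tile of the crossing through the side h, with south-west corner at q.
   The triangle left by the curve is the south-west half; the orientation of the
   surface agrees with that of the plane iff r holds (relative orientation). *)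
Definition mk_tile (r : bool) (q : point) (h : S) : tile :=
  let h' := opp h in
  let l1 u := if r then ccw u else ccw (ccw u) in
  let l2 u := if r then ccw (ccw u) else ccw u in
  Tile (q, true, l2 h) ((q.1.+1, q.2), false, l1 h')
       ((q.1, q.2.+1), true, l2 h') (q, false, l1 h).

(* Consecutive tiles have opposite relative orientations, and are glued along
   the third side of the triangle between the two crossings. *)
Fixpoint tiles_from (r : bool) (q : point) (h : S) (w : seq S) : seq tile :=
  let t := mk_tile r q h in
  t :: if w is h' :: w' then
         tiles_from (~~ r)
           (if h' == edge_label (tileE t) then (q.1, q.2.+1) else (q.1.+1, q.2))
           h' w'
       else [::].

(* Closed curve h :: w, cut in the triangle preceding the crossing of h. *)
Variables (h : S) (w : seq S).

Definition snake_tiles : seq tile := tiles_from true (0, 0)%N h w.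
Definition first_tile : tile := head (mk_tile true (0, 0)%N h) snake_tiles.
Definition last_tile : tile := last first_tile snake_tiles.

Definition snake_edges : {fset edge} :=
  (\bigcup_(t <- snake_tiles) tile_edges t)%fset.

(* The two copies of the third side of the triangle in which the curve is cut;
   the band graph is obtained from the snake graph by identifying them. *)
Definition cut_first : edge :=
  let t := first_tile in
  if edge_label (tileS t) == opp (last h w) then tileW t else tileS t.
Definition cut_last : edge :=
  let t := last_tile in
  if edge_label (tileN t) == h then tileE t else tileN t.

Definition glue (v : point) : point :=
  if v == edge_src cut_last then edge_src cut_first
  else if v == edge_tgt cut_last then edge_tgt cut_first else v.

(* Perfect matchings of the graph with edge set E whose vertices are
   the images under f of the endpoints of edges. *)
Definition perfect_matching (f : point -> point) (E P : {fset edge}) : bool :=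
  let inc v e := (f (edge_src e) == v) || (f (edge_tgt e) == v) in
  (P `<=` E)%fset &&
  all (fun v => #|` [fset e in P | inc v e]%fset| == 1%N)
      ([seq f (edge_src e) | e <- enum_fset E] ++
       [seq f (edge_tgt e) | e <- enum_fset E]).

Definition snake_matching : pred {fset edge} :=
  perfect_matching id snake_edges.

Definition band_edges : {fset edge} := (snake_edges `\ cut_last)%fset.
Definition band_matching : pred {fset edge} :=
  perfect_matching glue band_edges.

(* Good matchings extend to a perfect matching of the snake graph by
   a copy of the cut edge. *)
Definition good_matching (P : {fset edge}) : bool :=
  band_matching P &&
  (snake_matching (cut_last |` P)%fset || snake_matching (cut_first |` P)%fset).

Definition lift_matching (P : {fset edge}) : {fset edge} :=
  if snake_matching (cut_last |` P)%fset then (cut_last |` P)%fset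
  else (cut_first |` P)%fset.

(* The minimal matching uses boundary edges only, and avoids the two edges
   counterclockwise from the diagonal of the first tile (whose relative
   orientation is positive). *)
Definition is_boundary_edge (e : edge) : bool :=
  count (fun t => e \in tile_edges t) snake_tiles == 1%N.

Definition is_minimal_matching (P : {fset edge}) : bool :=
  [&& snake_matching P, all is_boundary_edge (enum_fset P),
      tileW first_tile \notin P & tileE first_tile \notin P].

Definition minimal_matching : {fset edge} :=
  head fset0 [seq P <- enum_fset (fpowerset snake_edges)
             | is_minimal_matching P].

Definition nth_tile (i : nat) : tile := nth first_tile snake_tiles i.

(* Tiles enclosed by the cycles of the symmetric difference of P and the minimal
   matching, i.e. the set of tiles with that boundary modulo 2. *)
Definition enclosed_tiles (P : {fset edge}) : {set 'I_(size w).+1} :=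
  let D := ((P `\` minimal_matching) `|` (minimal_matching `\` P))%fset in
  odflt set0 [pick J : {set 'I_(size w).+1} |
    [fset e in snake_edges | odd #|[set i in J | e \in tile_edges (nth_tile i)]|]%fset
    == D].

(* The Musiker-Schiffler-Williams band graph formula, evaluated at the
   elements X (labels of edges) and Y (coefficients) of a field. *)
Definition band_formula (F : fieldType) (X Y : S -> F) : F :=
  (\prod_(k <- h :: w) X k)^-1 *
  \sum_(P <- enum_fset (fpowerset band_edges) | good_matching P)
     (\prod_(e <- enum_fset P) X (edge_label e)) *
     \prod_(i in enclosed_tiles (lift_matching P)) Y (nth h (h :: w) i).

End BandGraph.

Definition band_expansion (S : orbifold) (F : fieldType) (X Y : S -> F)
    (w : seq S) : F :=
  if w is h :: w' then band_formula h w' X Y else 0.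

(* Cluster algebras of geometric type.  Rows [inl i] of the exchange matrix are
   mutable, rows [inr i] are frozen. *)
Section ClusterAlgebra.

Variables (I : finType) (F : fieldType).

Record seed := Seed { cluster : I -> F; exmat : I + I -> I -> int }.

Definition posp (z : int) : int := Num.max z 0.

Variable y : I -> F.

Definition extended_cluster (s : seed) (r : I + I) : F :=
  match r with inl i => cluster s i | inr i => y i end.

Definition mutate (s : seed) (k : I) : seed :=
  let b := exmat s in
  Seed
    (fun j => if j == k then
       (\prod_r extended_cluster s r ^ posp (b r k)
        + \prod_r extended_cluster s r ^ posp (- b r k)) / cluster s k
     else cluster s j)
    (fun r j => if (r == inl k) || (j == k) then - b r j
     else b r j + posp (b r k) * posp (b (inl k) j)
                - posp (- b r k) * posp (- b (inl k) j)).

Definition cluster_variable (s0 : seed) (z : F) : Prop :=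
  exists (ks : seq I) (j : I), z = cluster (foldl mutate s0 ks) j.

Inductive generated_subring (G : F -> Prop) : F -> Prop :=
| gen_in z : G z -> generated_subring G z
| gen_one : generated_subring G 1
| gen_sub z t : generated_subring G z -> generated_subring G t ->
    generated_subring G (z - t)
| gen_mul z t : generated_subring G z -> generated_subring G t ->
    generated_subring G (z * t).

(* The coefficients y are not inverted. *)
Definition cluster_algebra (s0 : seed) : F -> Prop :=
  generated_subring (fun z => cluster_variable s0 z \/ exists i, z = y i).

End ClusterAlgebra.

Section OrbifoldClusterAlgebra.

Variable O : orbifold.

Definition arc_of (h : O) : {set O} := [set h; opp h].
Definition arcs : {set {set O}} := [set arc_of h | h in ~: bdry O].
Definition arc : finType := {A : {set O} | A \in arcs}.

(* b_ij counts the triangles in which j follows i clockwise, minus those in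
   which j follows i counterclockwise; the column of a pending arc is doubled
   (weight 1/2): in the double cover such an arc j is a diagonal of a
   quadrilateral in which every side is repeated, x_j x_j' = x_a^2 + x_b^2. *)
Definition exchange_matrix (i j : arc) : int :=
  (if #|val j| == 1%N then 2 else 1) *
  \sum_(h in val i) \sum_(k in val j)
     (Posz (h == ccw k) - Posz (k == ccw h)).

Definition ambient_field : fieldType :=
  {fraction {mpoly int[#|arc| + #|arc|]}}.

Definition xvar (a : arc) : ambient_field :=
  tofrac ('X_(lshift #|arc| (enum_rank a)) : {mpoly int[#|arc| + #|arc|]}).
Definition yvar (a : arc) : ambient_field :=
  tofrac ('X_(rshift #|arc| (enum_rank a)) : {mpoly int[#|arc| + #|arc|]}).

Definition principal_seed : seed arc ambient_field :=
  Seed xvar (fun r j => match r with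
                        | inl i => exchange_matrix i j
                        | inr i => Posz (i == j)
                        end).

Definition orbifold_cluster_algebra : ambient_field -> Prop :=
  cluster_algebra yvar principal_seed.

(* Boundary segments have weight 1. *)
Definition side_x (h : O) : ambient_field := oapp xvar 1 (insub (arc_of h)).
Definition side_y (h : O) : ambient_field := oapp yvar 1 (insub (arc_of h)).

(* The Laurent polynomial of the closed curve w' of an unfolding p, specialized
   by sending the variables of an arc of the unfolding to those of its image. *)
Definition specialized_expansion (S : orbifold) (p : S -> O) (w' : seq S) :
    ambient_field :=
  band_expansion (fun h => side_x (p h)) (fun h => side_y (p h)) w'.

End OrbifoldClusterAlgebra.

(* The value of the formula depends neither on the unfolding nor on the lift,
   so f is determined by w. *)
Definition is_laurent_polynomial_of (O : orbifold) (w : seq O)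
    (f : ambient_field O) : Prop :=
  exists (S : orbifold) (p : S -> O) (w' : seq S),
    [/\ is_unfolding p, is_closed_lift p w w' & f = specialized_expansion p w'].

(* Main.v *)
(* Around the marked point, the ends of the arcs form one cycle, starting and
   finishing at the boundary side b.  The band graph of the boundary loop is a
   staircase whose good matchings correspond to the corners of the triangulation,
   so that f is a sum of corner weights: the length of a horocycle, with
   coefficients.  Let S(h) be the partial sum up to the end h, and X(h) the cluster
   variable of the arc of h.  A flip preserves the partial sums at the remaining
   ends, because of the exchange relation.
   When h is the first end of its arc, flips bring it next to b, and X(h) S(h) is
   then the cluster variable of the third side of the triangle on b and h, up to a
   monomial in the coefficients.  For a triangle (a, u, v), Ptolemy relations
   express X(a) S(a) through similar products at earlier ends, and the case where a
   is b, at the end of the cycle, gives f.  The coefficients are not invertible, so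
   the monomials have to be controlled: all elements involved are positive, and
   their valuations at the coefficients can therefore be computed. *)

From HB Require Import structures.
From mathcomp Require Import all_boot all_order all_algebra.
From mathcomp Require Import finmap.
From mathcomp Require Import mpoly.
From mathcomp Require Import ring lra zify.
Require Import Defs.

Set Implicit Arguments.
Unset Strict Implicit.
Unset Printing Implicit Defensive.

Import Order.TTheory GRing.Theory Num.Theory.
Local Open Scope ring_scope.

(** * Valuations of positive elements at the coefficients *)

(** Control of the monomials means the following. If [z1 = z2 + T] with [z1] and [z2] in the
    algebra, the quotient of [T] by its whole monomial in the coefficients is wanted, so that
    monomial must divide [z1] and [z2] as well, and the relation is divided by it before
    subtracting. The divisibility comes from the initial triangulation: the coefficient of a corner
    is the product of the [y] of all later ends, so the exponents decrease around the marked point,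
    and the corners entering [T] come after those entering [z2]. A flip can destroy this
    monotonicity, so each induction step starts again from the initial triangulation, and flipped
    ones serve only to exhibit cluster variables. The corner that closes the cycle has exponent 0,
    which is why no monomial is left in front of [f]. Pending arcs need no separate argument,
    because a flip is studied one new triangle at a time, and for a pending arc the two new
    triangles coincide. *)

Section Monomials.

Variables (I : finType) (K : fieldType) (y : I -> K).

Local Notation vec := {ffun I -> int}.

Definition ypow (e : vec) : K := \prod_i y i ^ e i.

Definition vmin (e e' : vec) : vec := [ffun i => Num.min (e i) (e' i)].

Lemma vminE e e' i : vmin e e' i = Num.min (e i) (e' i).
Proof. by rewrite ffunE. Qed.

(* [hv z e] says that [z] is positive and that its [y_i]-adic valuation is
   [e i]; positivity excludes cancellations in [hv_add]. *)
Record valuation (hv : K -> vec -> Prop) : Prop := Valuation {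
  hv_y : forall i, hv (y i) [ffun j => (j == i)%:R];
  hv_one : hv 1 0;
  hv_neq0 : forall z e, hv z e -> z != 0;
  hv_mul : forall z z' e e', hv z e -> hv z' e' -> hv (z * z') (e + e');
  hv_inv : forall z e, hv z e -> hv z^-1 (- e);
  hv_add : forall z z' e e', hv z e -> hv z' e' -> hv (z + z') (vmin e e');
  hv_uniq : forall z e e', hv z e -> hv z e' -> e = e'
}.

Variable hv : K -> vec -> Prop.
Hypothesis V : valuation hv.

Lemma y_neq0 i : y i != 0.
Proof. exact: hv_neq0 V _ _ (hv_y V i). Qed.

Lemma ypow0 : ypow 0 = 1.
Proof. by rewrite /ypow big1 // => i _; rewrite ffunE expr0z. Qed.

Lemma ypowD e e' : ypow (e + e') = ypow e * ypow e'.
Proof.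
by rewrite /ypow -big_split; apply: eq_bigr => i _; rewrite ffunE expfzDr ?y_neq0.
Qed.

Lemma hv_exp z e n : hv z e -> hv (z ^+ n) (e *+ n).
Proof.
move=> ze; elim: n => [|n IHn]; first by rewrite expr0 mulr0n; apply: hv_one.
by rewrite exprS mulrS; apply: (hv_mul V).
Qed.

Lemma hv_expz z e n : hv z e -> hv (z ^ n) (e *~ n).
Proof. by case: n => n ze; [|apply: (hv_inv V)]; apply: hv_exp. Qed.

Lemma hv_ypow e : hv (ypow e) e.
Proof.
have {2}-> : e = \sum_i [ffun j => (j == i)%:R] *~ e i.
  apply/ffunP => j; rewrite sum_ffunE (bigD1 j) //= big1 ?addr0.
    by rewrite ffunMzE ffunE eqxx intz.
  by move=> i neq_ij; rewrite ffunMzE ffunE eq_sym (negPf neq_ij) mul0rz.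
rewrite /ypow; elim/big_rec2: _ => [|i z e' _ IH]; first exact: hv_one.
by apply: (hv_mul V) => //; apply/hv_expz/(hv_y V).
Qed.

End Monomials.

(** * Valuations on the field of rational functions *)

Section Valuation.

Variable O : orbifold.

Local Notation I := (arc O).
Local Notation K := (ambient_field O).
Local Notation R := {mpoly int[#|I| + #|I|]}.
Local Notation frac := (@FracField.tofrac R).
Local Notation vec := {ffun I -> int}.

(* All variables but [y_i] are sent to 1, so that the exponent of ['X] is the
   [y_i]-degree; [None] sends all variables to 1. *)
Definition restrict (o : option I) : R -> {poly int} :=
  mmap (@polyC int)
    (fun l => if o is Some i then if l == rshift #|I| (enum_rank i) then 'X else 1
              else 1).

Definition lowest (P : {poly int}) (n : nat) : Prop :=
  exists2 Q : {poly int}, P = Q * 'X^n & 0 < Q`_0.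

Lemma lowestM P P' n n' : lowest P n -> lowest P' n' -> lowest (P * P') (n + n').
Proof.
move=> [Q -> Q0] [Q' -> Q0']; exists (Q * Q'); first by rewrite exprD; ring.
by rewrite coef0M mulr_gt0.
Qed.

Lemma lowestD P P' n n' : lowest P n -> lowest P' n' -> lowest (P + P') (minn n n').
Proof.
wlog le_nn' : P P' n n' / (n <= n')%N.
  move=> th Pn Pn'; case/orP: (leq_total n n') => le; first exact: th.
  by rewrite addrC minnC; apply: th.
move=> [Q -> Q0] [Q' -> Q0']; rewrite (minn_idPl le_nn').
exists (Q + Q' * 'X^(n' - n)).
  by rewrite mulrDl -mulrA -exprD subnK.
rewrite coefD coefMXn; case: ltnP => [_|_]; first by rewrite addr0.
by rewrite sub0n addr_gt0.
Qed.

Lemma lowest_uniq P n n' : lowest P n -> lowest P n' -> n = n'.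
Proof.
wlog le_nn' : n n' / (n <= n')%N.
  by move=> th Pn Pn'; case/orP: (leq_total n n') => le; [|apply/esym]; apply: th.
move=> [Q -> Q0] [Q' E Q0']; apply/eqP; rewrite eqn_leq le_nn' leqNgt.
apply/negP => lt_nn'; move: E; rewrite -(subnK le_nn') exprD mulrA => /mulIf.
rewrite expf_eq0 polyX_eq0 andbF => /(_ isT) E; move: Q0; rewrite E coefMXn.
by rewrite subn_gt0 lt_nn' ltxx.
Qed.

Lemma lowest_neq0 P n : lowest P n -> P != 0.
Proof.
move=> [Q -> Q0]; rewrite mulf_eq0 expf_eq0 polyX_eq0 andbF orbF.
by apply/eqP => Q_eq0; move: Q0; rewrite Q_eq0 coef0 ltxx.
Qed.

(** The index [None] makes nonvanishing independent of the existence of an arc. *)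
Definition ylowest (p : R) (m : option I -> nat) : Prop :=
  forall o, lowest (restrict o p) (m o).

Lemma ylowest_neq0 p m : ylowest p m -> p != 0.
Proof.
move=> /(_ None) /lowest_neq0 /eqP p_neq0; apply/eqP => p0; case: p_neq0.
by rewrite p0 /restrict raddf0.
Qed.

Lemma ylowestM p p' m m' :
  ylowest p m -> ylowest p' m' -> ylowest (p * p') (fun o => m o + m' o)%N.
Proof. by move=> pm pm' o; rewrite /restrict rmorphM; apply: lowestM (pm o) (pm' o). Qed.

Lemma ylowestD p p' m m' :
  ylowest p m -> ylowest p' m' -> ylowest (p + p') (fun o => minn (m o) (m' o)).
Proof. by move=> pm pm' o; rewrite /restrict raddfD; apply: lowestD (pm o) (pm' o). Qed.

(* [z] is a quotient of polynomials whose lowest [y_i]-coefficients are positive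
   at 1, and its [y_i]-adic valuation is [e i].  Sums of such elements do not
   cancel in lowest degree. *)
Definition has_val (z : K) (e : vec) : Prop :=
  exists p q : R, exists m n, [/\ ylowest p m, ylowest q n, z = frac p / frac q
    & forall i, e i = (m (Some i))%:Z - (n (Some i))%:Z].

Lemma has_val_neq0 z e : has_val z e -> z != 0.
Proof.
move=> [p [q [m [n [pm qn -> _]]]]].
by rewrite mulf_neq0 ?invr_eq0 ?tofrac_eq0 ?(ylowest_neq0 pm) ?(ylowest_neq0 qn).
Qed.

Lemma has_valM z z' e e' : has_val z e -> has_val z' e' -> has_val (z * z') (e + e').
Proof.
move=> [p [q [m [n [pm qn -> E]]]]] [p' [q' [m' [n' [pm' qn' -> E']]]]].
exists (p * p'), (q * q'), (fun o => m o + m' o)%N, (fun o => n o + n' o)%N.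
split; [exact: ylowestM|exact: ylowestM| |].
  by rewrite !rmorphM invfM mulrACA.
by move=> i; rewrite ffunE E E' !PoszD; ring.
Qed.

Lemma has_valV z e : has_val z e -> has_val z^-1 (- e).
Proof.
move=> [p [q [m [n [pm qn -> E]]]]]; exists q, p, n, m; split=> //.
  by rewrite invfM invrK mulrC.
by move=> i; rewrite ffunE E opprB.
Qed.

Lemma has_valD z z' e e' : has_val z e -> has_val z' e' -> has_val (z + z') (vmin e e').
Proof.
move=> [p [q [m [n [pm qn -> E]]]]] [p' [q' [m' [n' [pm' qn' -> E']]]]].
exists (p * q' + p' * q), (q * q').
exists (fun o => minn (m o + n' o) (m' o + n o))%N, (fun o => n o + n' o)%N.
split; [by apply: ylowestD; apply: ylowestM|exact: ylowestM| |].
  rewrite rmorphD !rmorphM addf_div ?tofrac_eq0 ?(ylowest_neq0 qn) //.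
  exact: ylowest_neq0 qn'.
by move=> i; rewrite ffunE E E'; lia.
Qed.

Lemma has_val_uniq z e e' : has_val z e -> has_val z e' -> e = e'.
Proof.
move=> [p [q [m [n [pm qn -> E]]]]] [p' [q' [m' [n' [pm' qn' /eqP eqz E']]]]].
move: eqz; rewrite eqr_div ?tofrac_eq0 ?(ylowest_neq0 qn) ?(ylowest_neq0 qn') //.
rewrite -!rmorphM tofrac_eq => /eqP eqpq; apply/ffunP => i.
have := ylowestM pm qn' (Some i); rewrite eqpq => /lowest_uniq.
by move/(_ _ (ylowestM pm' qn (Some i))); rewrite E E'; lia.
Qed.

Lemma restrict_X o l : restrict o 'X_l =
  if o is Some i then if l == rshift #|I| (enum_rank i) then 'X else 1 else 1.
Proof. by rewrite /restrict mmapX mmap1U. Qed.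

Lemma ylowest_X l : ylowest 'X_l
  (fun o => if o is Some i then l == rshift #|I| (enum_rank i) : nat else 0%N).
Proof.
move=> o; rewrite restrict_X; exists 1; last by rewrite coef1.
by case: o => [i|]; rewrite mul1r; first case: eqP.
Qed.

Lemma has_val_frac p m : ylowest p m -> has_val (frac p) [ffun i => (m (Some i))%:Z].
Proof.
move=> pm; exists p, 1, m, (fun=> 0%N); split=> //.
- by move=> o; rewrite /restrict rmorph1; exists 1; rewrite ?coef1 // mul1r expr0.
- by rewrite rmorph1 divr1.
- by move=> i; rewrite ffunE subr0.
Qed.

Lemma has_val_xvar i : has_val (xvar i) 0.
Proof.
have := has_val_frac (ylowest_X (lshift #|I| (enum_rank i))).
by congr has_val; apply/ffunP => j; rewrite !ffunE eq_lrshift.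
Qed.

Lemma has_val_yvar i : has_val (yvar i) [ffun j => (j == i)%:R].
Proof.
have := has_val_frac (ylowest_X (rshift #|I| (enum_rank i))).
congr has_val; apply/ffunP => j; rewrite !ffunE eq_rshift.
by rewrite (inj_eq enum_rank_inj) eq_sym; case: eqP.
Qed.

Lemma has_val1 : has_val 1 0.
Proof.
have low1 : ylowest 1 (fun=> 0%N).
  by move=> o; rewrite /restrict rmorph1; exists 1; rewrite ?coef1 // mul1r expr0.
have := has_val_frac low1; rewrite rmorph1.
by congr has_val; apply/ffunP => j; rewrite !ffunE.
Qed.

Lemma has_val_valuation : valuation (@yvar O) has_val.
Proof.
split; [exact: has_val_yvar|exact: has_val1|exact: has_val_neq0|exact: has_valM
  |exact: has_valV|exact: has_valD|exact: has_val_uniq].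
Qed.

End Valuation.

(** * Corner sums under flips *)

(** Ptolemy's relation in a quadrilateral with diagonals [xk] and [x']: the new diagonal cuts the
    corner facing [xk] into two. In [merge_corners] the removal of the old diagonal unites the two
    corners at one of its endpoints. *)
Lemma split_corner (F : fieldType) (S0 y ep en xk xp xq xr xt x' : F) :
  [&& xp != 0, xq != 0 & x' != 0] ->
  xk * x' = ep * xp * xr + en * xq * xt ->
  S0 + y * xk / (xq * xp) =
  S0 + y * en * xt / (xp * x') + y * ep * xr / (x' * xq).
Proof.
case/and3P=> p0 q0 x0 E; have -> : xk = (ep * xp * xr + en * xq * xt) / x'.
  by rewrite -E mulfK.
by field; rewrite p0 q0 x0.
Qed.

Lemma merge_corners (F : fieldType) (S0 y ep en xk xp xq xr xt x' : F) :
  [&& xk != 0, xq != 0 & xr != 0] ->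
  xk * x' = ep * xp * xr + en * xq * xt ->
  S0 + y * ep * xp / (xq * xk) + y * en * xt / (xk * xr) = S0 + y * x' / (xq * xr).
Proof.
case/and3P=> k0 q0 r0 E; have -> : x' = (ep * xp * xr + en * xq * xt) / xk.
  by rewrite -E mulrC mulKf.
by field; rewrite k0 q0 r0.
Qed.

Ltac vec_ring := apply/ffunP => ?; rewrite !ffunE; ring.

(** * Triangulations carrying partial corner sums *)

Section Marking.

Variable O : orbifold.

Local Notation I := (arc O).
Local Notation vec := {ffun I -> int}.

Lemma val_arc (i : I) (h : O) : h \in val i -> val i = [set h; opp h].
Proof.
have /imsetP[g _ ->] := valP i; rewrite /arc_of !inE => /orP[] /eqP -> //.
by rewrite oppK setUC.
Qed.

Lemma arc_ex (h : O) : h \notin bdry O -> exists i : I, h \in val i.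
Proof.
move=> hb; have hA : arc_of h \in arcs O by apply/imsetP; exists h; rewrite // inE.
by exists (exist _ (arc_of h) hA : I); rewrite !inE eqxx.
Qed.

Lemma arc_bdry (i : I) (h : O) : h \in bdry O -> h \in val i = false.
Proof.
move=> hb; have /imsetP[g gb ->] := valP i; rewrite /arc_of !inE in gb *.
apply/negP => /orP[] /eqP E; first by rewrite -E hb in gb.
by move: gb; rewrite -[g]oppK -E opp_bdry // hb.
Qed.

Lemma opp_arc (i : I) (h : O) : h \in val i -> opp h \in val i.
Proof. by move=> hi; rewrite (val_arc hi) !inE eqxx orbT. Qed.

Lemma arc_uniq (i j : I) (h : O) : h \in val i -> h \in val j -> i = j.
Proof. by move=> hi hj; apply: val_inj; rewrite (val_arc hi) (val_arc hj). Qed.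

Definition vpos (e : vec) : vec := [ffun i => posp (e i)].

Lemma posp_sub (z : int) : posp z - posp (- z) = z.
Proof.
by rewrite /posp !maxEle oppr_le0; case: (lerP 0 z); case: (lerP z 0); lia.
Qed.

Lemma posp_min (z : int) : Num.min (posp z) (posp (- z)) = 0.
Proof.
rewrite /posp; have /orP[z0|z0] := le_total 0 z.
  by rewrite (max_l z0) (max_r (_ : - z <= 0)) ?oppr_le0 // min_r.
by rewrite (max_r z0) (max_l (_ : 0 <= - z)) ?oppr_ge0 // min_l ?oppr_ge0.
Qed.

Lemma vposE e i : vpos e i = posp (e i).
Proof. by rewrite ffunE. Qed.

Lemma vpos_sub e : vpos e - vpos (- e) = e.
Proof. by apply/ffunP => i; rewrite !ffunE posp_sub. Qed.

Lemma vmin_vpos e : vmin (vpos e) (vpos (- e)) = 0.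
Proof. by apply/ffunP => i; rewrite !ffunE posp_min. Qed.

Lemma vposN e : vpos (- e) = vpos e - e.
Proof. by rewrite -{3}[e]vpos_sub opprB addrC subrK. Qed.

Variables (K : fieldType) (y : I -> K) (hv : K -> vec -> Prop).
Hypothesis V : valuation y hv.

Variables (b : O) (f : K).
Hypothesis bdry_b : bdry O = [set b].

Lemma opp_b : opp b = b.
Proof. by apply: opp_bdry; rewrite bdry_b inE. Qed.

Lemma opp_eqb h : (opp h == b) = (h == b).
Proof. by rewrite -{1}opp_b (inj_eq (inv_inj (@oppK O))). Qed.

(* A triangulation of the surface, whose sides are still named by [O]; [mccw] is
   the successor in a triangle.  An end of an arc is named by the side that starts
   there.  [mpos h] is the position of the end [h] around the marked point, [mS h]
   the sum of the weights of the corners between [b] and [h], and [mZ h] the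
   exponent of the coefficient of the corner between the ends [opp h] and
   [mccw h].  The side [b] occurs twice, as the first and as the last end: [mpos]
   and [mS] refer to the first occurrence, [hi] and [Shi] to the last one, where
   the sum is [f]. *)
Record marking := Marking {
  mccw : O -> O;
  mX : O -> K;
  mS : O -> K;
  mZ : O -> vec;
  mm : O -> vec;
  mpos : O -> rat
}.

Definition hi (M : marking) (h : O) : rat := if h == b then 1 else mpos M h.
Definition Shi (M : marking) (h : O) : K := if h == b then f else mS M h.

Record marked (M : marking) (s : seed I K) : Prop := Marked {
  mccw_neq : forall h, mccw M h != h;
  mccw3 : forall h, mccw M (mccw M (mccw M h)) = h;
  mX_b : mX M b = 1;
  mX_arc : forall (i : I) h, h \in val i -> mX M h = cluster s i;
  mX_val : forall h, hv (mX M h) 0;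
  mS_b : mS M b = 0;
  mS_ccw : forall h, Shi M (mccw M h) = mS M (opp h)
     + ypow y (mZ M h) * mX M (mccw M (mccw M h)) / (mX M h * mX M (mccw M h));
  mZ_mm : forall h, mZ M h + mZ M (mccw M (mccw M h)) = mm M h;
  mm_opp : forall h, mm M (opp h) = mm M h;
  mpos_b : mpos M b = 0;
  mpos_gt0 : forall h, h != b -> 0 < mpos M h;
  mpos_lt1 : forall h, mpos M h < 1;
  mpos_inj : injective (mpos M);
  mpos_ccw : forall h, mpos M (opp h) < hi M (mccw M h);
  mpos_gap : forall h x, (mpos M x <= mpos M (opp h)) || (hi M (mccw M h) <= mpos M x);
  exmat_mut : forall (i j : I) g, g \in val j -> exmat s (inl i) j =
    (mccw M g \in val i)%:Z - (mccw M (mccw M g) \in val i)%:Z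
    + (mccw M (opp g) \in val i)%:Z - (mccw M (mccw M (opp g)) \in val i)%:Z;
  exmat_frozen : forall (i j : I) g, g \in val j ->
    exmat s (inr i) j = (mZ M (mccw M (mccw M g)) - mZ M (opp g)) i
}.

(** * Order of the ends, and construction of a flip *)

Section Flip.

Variables (M : marking) (s : seed I K).
Hypothesis Ms : marked M s.

Local Notation c := (mccw M).

Lemma mccw_inj : injective c.
Proof. by move=> h h' E; rewrite -(mccw3 Ms h) E (mccw3 Ms). Qed.

Lemma mccw2_neq h : c (c h) != h.
Proof. by rewrite -{2}(mccw3 Ms h) eq_sym (mccw_neq Ms). Qed.

Lemma hi_nb h : h != b -> hi M h = mpos M h.
Proof. by rewrite /hi => /negPf->. Qed.

Lemma Shi_nb h : h != b -> Shi M h = mS M h.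
Proof. by rewrite /Shi => /negPf->. Qed.

(** Equality would make the corner of [h] run from an end to itself, as in a self-folded triangle.
    Positions increase across a corner, and the only end with two positions, [b], is excluded by
    [mccw_neq]. *)
Lemma mccw_opp h : c h != opp h.
Proof.
apply/eqP => E; have := mpos_ccw Ms h; rewrite E /hi; case: eqP => [E'|_].
  have hb : h = b by apply/eqP; rewrite -opp_eqb E'.
  by have := mccw_neq Ms h; rewrite E hb opp_b eqxx.
by rewrite ltxx.
Qed.

Lemma mccw2_opp h : c (c h) != opp h.
Proof.
apply/eqP => E; have := mccw_opp (opp h).
by rewrite oppK -E (mccw3 Ms) eqxx.
Qed.

Lemma mX_opp h : mX M (opp h) = mX M h.
Proof.
have [hb|hb] := boolP (h \in bdry O); first by rewrite opp_bdry.
have [i hi] := arc_ex hb.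
by rewrite (mX_arc Ms hi) (mX_arc Ms (opp_arc hi)).
Qed.

Lemma mX_neq0 h : mX M h != 0.
Proof. exact: (hv_neq0 V) (mX_val Ms h). Qed.

Lemma mpos_ge0 h : 0 <= mpos M h.
Proof.
by have [->|hb] := eqVneq h b; [rewrite (mpos_b Ms)|apply/ltW/(mpos_gt0 Ms)].
Qed.

Lemma hi_le1 h : hi M h <= 1.
Proof. by rewrite /hi; case: eqP => // _; apply/ltW/(mpos_lt1 Ms). Qed.

(** Position of an end inserted in the corner of [h]. Rational positions always leave room, so the
    other ends are never renumbered. *)
Definition mid h : rat := (mpos M (opp h) + hi M (c h)) / 2.

Lemma mid_gap h g : h != g -> mid h < mpos M (opp g) \/ hi M (c g) < mid h.
Proof.
move=> neq_hg.
have pos_neq : mpos M (opp h) != mpos M (opp g).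
  by rewrite (inj_eq (mpos_inj Ms)) (inj_eq (inv_inj (@oppK O))).
have lth := mpos_ccw Ms h; have ltg := mpos_ccw Ms g.
have := mpos_gap Ms h (opp g); have := mpos_gap Ms g (opp h).
move: pos_neq; rewrite /mid neq_lt => /orP[] lt_hg /orP[] le1 /orP[] le2.
all: first [by left; lra | by right; lra].
Qed.

Lemma mid_bound h : mpos M (opp h) < mid h < hi M (c h).
Proof. by rewrite /mid; have := mpos_ccw Ms h => lth; apply/andP; split; lra. Qed.

Lemma mid_neq h x : mid h != mpos M x.
Proof.
have /andP[lt1 lt2] := mid_bound h.
by have /orP[le|le] := mpos_gap Ms h x; apply/eqP; lra.
Qed.

Variable k : O.

Let k' := opp k.
Let p := c k.
Let q := c p.
Let r := c k'.
Let t := c r.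

Definition flip_exp : vec := mZ M q - mZ M k'.

(* Replaces the diagonal [k] of the quadrilateral [p], [q], [r], [t] by the
   other one.  When [k] is pending, [r] and [t] coincide with [p] and [q], and
   the first branch that applies is the right one. *)
Definition flip_upd T (g : O -> T) tk tq tr tk' tt tp : O -> T := fun h =>
  if h == k then tk else if h == q then tq else if h == r then tr
  else if h == k' then tk' else if h == t then tt else if h == p then tp
  else g h.

Definition arc_upd T (g : O -> T) tk tk' : O -> T := fun h =>
  if h == k then tk else if h == k' then tk' else g h.

Definition flip_X : K :=
  (ypow y (vpos flip_exp) * mX M p * mX M r
   + ypow y (vpos (- flip_exp)) * mX M q * mX M t) / mX M k.

(** A merged corner receives the componentwise minimum of two exponents: [mZ M q - ep] is the
    minimum of [mZ M q] and [mZ M k']. A corner of exponent [z] cut by the new diagonal yields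
    [z + ep] and [z + en], with minimum [z]. The new [k] goes from the end of [r] to the end of [p],
    hence the two midpoints. *)
Definition flip : marking :=
  let ep := vpos flip_exp in let en := vpos (- flip_exp) in
  Marking
    (flip_upd c q r k t p k')
    (arc_upd (mX M) flip_X flip_X)
    (arc_upd (mS M)
      (mS M (opp r) + ypow y (mZ M r + en) * mX M q / (mX M r * flip_X))
      (mS M (opp p) + ypow y (mZ M p + en) * mX M t / (mX M p * flip_X)))
    (flip_upd (mZ M) (mZ M p + ep) (mZ M q - ep) (mZ M r + en)
                     (mZ M r + ep) (mZ M t - ep) (mZ M p + en))
    (arc_upd (mm M) (mZ M p + mZ M r + ep + en) (mZ M p + mZ M r + ep + en))
    (arc_upd (mpos M) (mid r) (mid p)).

(** The six sides are distinct, unless [k] is pending, when they coincide in pairs and the values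
    must agree. *)
Lemma flip_updE T (g : O -> T) tk tq tr tk' tt tp :
  (opp k = k -> [/\ tk = tk', tr = tp & tq = tt]) ->
  let g' := flip_upd g tk tq tr tk' tt tp in
  [/\ [/\ g' k = tk, g' q = tq & g' r = tr],
      [/\ g' k' = tk', g' t = tt & g' p = tp]
    & forall h, h \notin [:: k; q; r; k'; t; p] -> g' h = g h].
Proof.
have qk : q != k by apply: mccw2_neq.
have tk1 : t != k' by apply: mccw2_neq.
have rk1 : r != k' by apply: mccw_neq Ms _.
have pk : p != k by apply: mccw_neq Ms _.
have rk : r != k by have := mccw_opp k'; rewrite /k' oppK.
have tk0 : t != k by have := mccw2_opp k'; rewrite /k' oppK.
have pk1 : p != k' by apply: mccw_opp.
have qk1 : q != k' by apply: mccw2_opp.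
have rq : r != q.
  by rewrite (inj_eq mccw_inj) eq_sym.
have tp0 : t != p.
  by rewrite (inj_eq mccw_inj).
have qp : p != q by rewrite eq_sym (mccw_neq Ms).
have rt : r != t by rewrite eq_sym (mccw_neq Ms).
have other : forall h, h \notin [:: k; q; r; k'; t; p] ->
    flip_upd g tk tq tr tk' tt tp h = g h.
  move=> h; rewrite !inE !negb_or => /and5P[h1 h2 h3 h4 /andP[h5 h6]].
  by rewrite /flip_upd !(negPf h1, negPf h2, negPf h3, negPf h4, negPf h5, negPf h6).
have [kk|kk] := eqVneq k' k; first case/(_ kk) => e1 e2 e3.
  have rp : r = p by rewrite /r /p kk.
  have tq0 : t = q by rewrite /t /q rp.
  split=> //; rewrite /flip_upd ?tq0 ?rp ?kk ?eqxx ?(negPf qk) ?(negPf pk).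
  - by rewrite (negPf qp).
  - by rewrite (negPf qp).
move=> _; split=> //; rewrite /flip_upd ?eqxx.
  by rewrite (negPf qk) (negPf rk) (negPf rq).
rewrite (negPf kk) [k' == q]eq_sym (negPf qk1) [k' == r]eq_sym (negPf rk1).
rewrite (negPf tk0) (negPf tk1) (negPf pk) (negPf pk1) (negPf qp).
rewrite [t == r]eq_sym (negPf rt) [p == t]eq_sym (negPf tp0).
have -> : (t == q) = false.
  by rewrite (inj_eq mccw_inj) /r /p (inj_eq mccw_inj) (negPf kk).
by rewrite /r /p (inj_eq mccw_inj) [k == _]eq_sym (negPf kk).
Qed.

End Flip.

(** * A flip seen from one of its new triangles *)

Definition quad (M : marking) (k : O) : seq O :=
  let c := mccw M in
  [:: k; c (c k); c (opp k); opp k; c (c (opp k)); c k].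

(** Describes one new triangle only; exchanging [k] and [opp k] gives the other, so that each
    verification is made once. *)
Record half_flip (M M' : marking) (k : O) : Prop := HalfFlip {
  hf_c : mccw M' k = mccw M (mccw M k);
  hf_cq : mccw M' (mccw M (mccw M k)) = mccw M (opp k);
  hf_cr : mccw M' (mccw M (opp k)) = k;
  hf_Z : mZ M' k = mZ M (mccw M k) + vpos (flip_exp M k);
  hf_Zq : mZ M' (mccw M (mccw M k)) = mZ M (mccw M (mccw M k)) - vpos (flip_exp M k);
  hf_Zr : mZ M' (mccw M (opp k)) = mZ M (mccw M (opp k)) + vpos (- flip_exp M k);
  hf_X : mX M' k = flip_X M k;
  hf_S : mS M' k = mS M (opp (mccw M (opp k)))
    + ypow y (mZ M' (mccw M (opp k))) * mX M (mccw M (mccw M k))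
      / (mX M (mccw M (opp k)) * mX M' k);
  hf_m : mm M' k = mZ M (mccw M k) + mZ M (mccw M (opp k))
    + vpos (flip_exp M k) + vpos (- flip_exp M k);
  hf_pos : mpos M' k = mid M (mccw M (opp k))
}.

Record flipped (M M' : marking) (k : O) : Prop := Flipped {
  fl_k : half_flip M M' k;
  fl_k' : half_flip M M' (opp k);
  fl_c : forall h, h \notin quad M k -> mccw M' h = mccw M h /\ mZ M' h = mZ M h;
  fl_X : forall h, h != k -> h != opp k ->
    [/\ mX M' h = mX M h, mS M' h = mS M h, mm M' h = mm M h & mpos M' h = mpos M h]
}.

Lemma flipped_sym M M' k : flipped M M' k -> flipped M M' (opp k).
Proof.
case=> H1 H2 H3 H4; split; rewrite ?oppK //.
  move=> h hn; apply: H3; move: hn; rewrite !inE oppK.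
  by rewrite !negb_or => /and5P[-> -> -> -> /andP[-> ->]].
by move=> h h1 h2; apply: H4.
Qed.

(** By [mm_opp], the jump of exponents across the diagonal can be read at either of its ends. *)
Lemma flip_exp_opp M s k : marked M s -> flip_exp M (opp k) = flip_exp M k.
Proof.
move=> Ms; rewrite /flip_exp oppK.
have := mm_opp Ms k; rewrite -!(mZ_mm Ms) => E.
by apply/eqP; rewrite subr_eq addrAC eq_sym subr_eq eq_sym addrC -E addrC.
Qed.

Lemma flip_X_opp M s k : marked M s -> flip_X M (opp k) = flip_X M k.
Proof.
move=> Ms; rewrite /flip_X (flip_exp_opp _ Ms) oppK (mX_opp Ms).
by congr (_ / _); ring.
Qed.

Lemma flipP M s k : marked M s -> flipped M (flip M k) k.
Proof.
move=> Ms.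
pose p := mccw M k; pose q := mccw M p; pose r := mccw M (opp k); pose t := mccw M r.
have upd T := @flip_updE M s Ms k T.
have arc1 T (g : O -> T) u v : arc_upd k g u v k = u by rewrite /arc_upd eqxx.
have arc2 T (g : O -> T) u v : (opp k = k -> u = v) -> arc_upd k g u v (opp k) = v.
  by rewrite /arc_upd; case: eqVneq => [E /(_ E)//|_ _]; rewrite eqxx.
have [|[c1 c2 c3] [c4 c5 c6] c7] := upd _ (mccw M) q r k t p (opp k).
  by move=> kk; rewrite /q /t /r /p kk.
have tq : opp k = k -> t = q by rewrite /t /r /q /p => ->.
have rp : opp k = k -> r = p by rewrite /r /p => ->.
pose ep := vpos (flip_exp M k); pose en := vpos (- flip_exp M k).
have [|[z1 z2 z3] [z4 z5 z6] z7] :=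
    upd _ (mZ M) (mZ M p + ep) (mZ M q - ep) (mZ M r + en)
                 (mZ M r + ep) (mZ M t - ep) (mZ M p + en).
  by move=> kk; rewrite rp // tq.
split.
- split=> //=; rewrite ?arc1 //.
  by rewrite z3.
- split; rewrite ?oppK ?(flip_exp_opp _ Ms) ?(flip_X_opp _ Ms) //=.
  + by rewrite arc2.
  + by rewrite !arc2 // ?z6 // => ->.
  + by rewrite arc2 // [_ + mZ M (mccw M k)]addrC.
  + by rewrite arc2 // => ->.
- by move=> h hn; rewrite /= c7 // z7.
- by move=> h h1 h2; rewrite /= /arc_upd (negPf h1) (negPf h2).
Qed.

Section Flipped.

Variables (M M' : marking) (s : seed I K) (k : O).
Hypotheses (Ms : marked M s) (kb : k != b) (F : flipped M M' k).

Local Notation c := (mccw M).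
Local Notation c' := (mccw M').

Let oppkb : opp k != b. Proof. by rewrite opp_eqb. Qed.

Let pk : c k != k. Proof. exact: mccw_neq Ms k. Qed.
Let qk : c (c k) != k. Proof. exact: mccw2_neq Ms k. Qed.
Let pk' : c k != opp k. Proof. exact: mccw_opp Ms k. Qed.
Let qk' : c (c k) != opp k. Proof. exact: mccw2_opp Ms k. Qed.
Let rk : c (opp k) != k. Proof. by have := mccw_opp Ms (opp k); rewrite oppK. Qed.
Let tk : c (c (opp k)) != k. Proof. by have := mccw2_opp Ms (opp k); rewrite oppK. Qed.
Let rk' : c (opp k) != opp k. Proof. exact: mccw_neq Ms _. Qed.
Let tk' : c (c (opp k)) != opp k. Proof. exact: mccw2_neq Ms _. Qed.

Let opp_neq x : x != k -> x != opp k -> opp x != k /\ opp x != opp k.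
Proof.
by move=> h1 h2; split; rewrite ?(inj_eq (inv_inj (@oppK O))) // -[k]oppK
   (inj_eq (inv_inj (@oppK O))).
Qed.

Let X'E h : h != k -> h != opp k -> mX M' h = mX M h.
Proof. by move=> h1 h2; case: (fl_X F h1 h2). Qed.
Let S'E h : h != k -> h != opp k -> mS M' h = mS M h.
Proof. by move=> h1 h2; case: (fl_X F h1 h2). Qed.
Let m'E h : h != k -> h != opp k -> mm M' h = mm M h.
Proof. by move=> h1 h2; case: (fl_X F h1 h2). Qed.
Let pos'E h : h != k -> h != opp k -> mpos M' h = mpos M h.
Proof. by move=> h1 h2; case: (fl_X F h1 h2). Qed.
Let Shi'E h : h != k -> h != opp k -> Shi M' h = Shi M h.
Proof. by move=> h1 h2; rewrite /Shi S'E. Qed.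
Let hi'E h : h != k -> h != opp k -> hi M' h = hi M h.
Proof. by move=> h1 h2; rewrite /hi pos'E. Qed.

Let X'k : mX M' k = flip_X M k. Proof. exact: hf_X (fl_k F). Qed.
Let X'k' : mX M' (opp k) = flip_X M k.
Proof. by rewrite (hf_X (fl_k' F)) (flip_X_opp _ Ms). Qed.

(** The coefficients of the two exchange monomials are coprime, and positivity makes the valuation
    of their sum the minimum. *)
Lemma flip_X_val : hv (flip_X M k) 0.
Proof.
rewrite /flip_X; set ep := vpos _; set en := vpos _.
have -> : 0 = vmin (ep + 0 + 0) (en + 0 + 0) + - 0 :> vec.
  by rewrite !addr0 oppr0 addr0 vmin_vpos.
apply: (hv_mul V); last by apply/(hv_inv V)/(mX_val Ms).
by apply: (hv_add V); do 2!(apply: (hv_mul V); last exact: mX_val Ms _);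
  apply: (hv_ypow V).
Qed.

Let flip_X_neq0 : flip_X M k != 0. Proof. exact: (hv_neq0 V) flip_X_val. Qed.

Lemma exchangeE : mX M k * flip_X M k =
  ypow y (vpos (flip_exp M k)) * mX M (c k) * mX M (c (opp k))
  + ypow y (vpos (- flip_exp M k)) * mX M (c (c k)) * mX M (c (c (opp k))).
Proof. by rewrite /flip_X mulrC divfK ?(mX_neq0 Ms). Qed.

Lemma fl_cat h : h \notin quad M k ->
  [/\ c' h = c h, mZ M' h = mZ M h, c h \notin quad M k, h != k & h != opp k].
Proof.
move=> hn; have [-> ->] := fl_c F hn; move: hn; rewrite /quad !inE !negb_or.
have inj := inj_eq (mccw_inj Ms).
have c3 := mccw3 Ms.
case/and5P=> h1 h2 h3 h4 /andP[h5 h6]; split=> //.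
have e x : (c h == x) = (h == c (c x)) by rewrite -{1}(c3 x) inj.
by rewrite !e !c3 h1 h2 h3 h4 h5 h6.
Qed.

Lemma half_ccw_neq : [/\ c' k != k, c' (c (c k)) != c (c k) & c' (c (opp k)) != c (opp k)].
Proof.
rewrite (hf_c (fl_k F)) (hf_cq (fl_k F)) (hf_cr (fl_k F)).
by split=> //; rewrite ?(inj_eq (mccw_inj Ms)) eq_sym.
Qed.

Lemma half_ccw3 x : x \in [:: k; c (c k); c (opp k)] -> c' (c' (c' x)) = x.
Proof.
by rewrite !inE => /or3P[] /eqP ->;
  rewrite ?(hf_c (fl_k F), hf_cq (fl_k F), hf_cr (fl_k F)).
Qed.

(** Of the three corners of the new triangle, the one at the end of [k] is part of a split corner,
    the one at the end of [c (c k)] is a merged corner, and the last one is the definition of the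
    new partial sum. *)
Lemma half_S x : x \in [:: k; c (c k); c (opp k)] -> Shi M' (c' x) = mS M' (opp x)
     + ypow y (mZ M' x) * mX M' (c' (c' x)) / (mX M' x * mX M' (c' x)).
Proof.
have XN := mX_neq0 Ms.
rewrite !inE => /or3P[] /eqP ->;
  rewrite ?(hf_c (fl_k F), hf_cq (fl_k F), hf_cr (fl_k F)).
- rewrite Shi'E // (hf_S (fl_k' F)) oppK (X'E rk rk') X'k X'k' !X'E //.
  have := mS_ccw Ms (c k); rewrite (mccw3 Ms) => ->.
  have := hf_Zr (fl_k' F); rewrite oppK => ->.
  rewrite (hf_Z (fl_k F)) (flip_exp_opp _ Ms) !(ypowD V) [mX M (c k) * mX M (c (c k))]mulrC.
  by apply: split_corner exchangeE; rewrite !XN flip_X_neq0.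
- have [oc1 oc2] := opp_neq qk qk'.
  rewrite Shi'E // (S'E oc1 oc2) X'k !X'E // (hf_Zq (fl_k F)).
  have := mS_ccw Ms (opp k); rewrite oppK => ->.
  have := mS_ccw Ms (c (c k)); rewrite (mccw3 Ms) Shi_nb // => ->.
  (* Both old exponents are written over their minimum, the exponent of the merged corner. *)
  have -> : mZ M (opp k) = mZ M (c (c k)) - vpos (flip_exp M k) + vpos (- flip_exp M k).
    by rewrite vposN addrA subrK /flip_exp opprB addrC subrK.
  have {1}-> : mZ M (c (c k)) = mZ M (c (c k)) - vpos (flip_exp M k) + vpos (flip_exp M k).
    by rewrite subrK.
  rewrite (mX_opp Ms) !(ypowD V (_ - _)).
  by apply: merge_corners exchangeE; rewrite !XN.
- have [oc1 oc2] := opp_neq rk rk'.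
  by rewrite Shi_nb // (hf_S (fl_k F)) (S'E oc1 oc2) (X'E qk qk') (X'E rk rk').
Qed.

Lemma half_Z_mm x : x \in [:: k; c (c k); c (opp k)] ->
  mZ M' x + mZ M' (c' (c' x)) = mm M' x.
Proof.
have Ek : flip_exp M k = mZ M (c (c k)) - mZ M (opp k) by [].
have Ek' : flip_exp M k = mZ M (c (c (opp k))) - mZ M k.
  by rewrite -(flip_exp_opp k Ms) /flip_exp oppK.
have Em1 := mZ_mm Ms (c (c k)); have Em2 := mZ_mm Ms (c (opp k)).
rewrite !(mccw3 Ms) in Em1 Em2.
rewrite !inE => /or3P[] /eqP ->;
  rewrite ?(hf_c (fl_k F), hf_cq (fl_k F), hf_cr (fl_k F)).
- by rewrite (hf_Z (fl_k F)) (hf_Zr (fl_k F)) (hf_m (fl_k F)); vec_ring.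
- by rewrite (hf_Zq (fl_k F)) (hf_Z (fl_k F)) m'E // -Em1; vec_ring.
- rewrite (hf_Zr (fl_k F)) (hf_Zq (fl_k F)) m'E // -Em2.
  by rewrite vposN Ek; vec_ring.
Qed.

Lemma half_pos x : x \in [:: k; c (c k); c (opp k)] -> mpos M' (opp x) < hi M' (c' x).
Proof.
rewrite !inE => /or3P[] /eqP ->;
  rewrite ?(hf_c (fl_k F), hf_cq (fl_k F), hf_cr (fl_k F)).
- rewrite (hf_pos (fl_k' F)) oppK hi'E //.
  by have /andP[] := mid_bound Ms (c k).
- have [oc1 oc2] := opp_neq qk qk'; rewrite pos'E // hi'E //.
  have := mpos_ccw Ms (c (c k)); have := mpos_ccw Ms (opp k).
  by rewrite oppK (mccw3 Ms) (hi_nb M kb) => lt2 lt1; apply: lt_trans lt1 lt2.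
- have [oc1 oc2] := opp_neq rk rk'; rewrite pos'E // (hi_nb M' kb) (hf_pos (fl_k F)).
  by have /andP[] := mid_bound Ms (c (opp k)).
Qed.

(** In a split corner the new end is one of the two bounds; in the merged corner the only end in
    between was [k], which has moved. *)
Lemma half_gap x g : x \in [:: k; c (c k); c (opp k)] ->
  (mpos M' g <= mpos M' (opp x)) || (hi M' (c' x) <= mpos M' g).
Proof.
have gap_mid h a : h != a -> (mid M h <= mpos M (opp a)) || (hi M (c a) <= mid M h).
  by move=> /(mid_gap Ms)[/ltW->|/ltW->]; rewrite ?orbT.
have pos_g : [\/ mpos M' g = mpos M g /\ (g != k /\ g != opp k), mpos M' g = mid M (c (opp k)) | mpos M' g = mid M (c k)].
  have [->|gk] := eqVneq g k; first by apply: Or32; apply: hf_pos (fl_k F).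
  have [->|gk'] := eqVneq g (opp k).
    by apply: Or33; rewrite (hf_pos (fl_k' F)) oppK.
  by apply: Or31; rewrite pos'E.
rewrite !inE => /or3P[] /eqP ->;
  rewrite ?(hf_c (fl_k F), hf_cq (fl_k F), hf_cr (fl_k F)).
- rewrite (hf_pos (fl_k' F)) oppK hi'E //.
  have /andP[m1 m2] := mid_bound Ms (c k).
  case: pos_g => [[-> _]|->|->].
  + by have /orP[le|le] := mpos_gap Ms (c k) g; apply/orP; [left|right]; lra.
  + have [->|rp] := eqVneq (c (opp k)) (c k); first by rewrite lexx.
    by have /orP[le|le] := gap_mid _ _ rp; apply/orP; [left|right]; lra.
  + by rewrite lexx.
- have [oc1 oc2] := opp_neq qk qk'; rewrite (pos'E oc1 oc2) (hi'E rk rk').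
  have gap h : (mpos M h <= mpos M (opp (c (c k)))) || (mpos M k <= mpos M h).
    by have := mpos_gap Ms (c (c k)) h; rewrite (mccw3 Ms) hi_nb.
  have gap' h : (mpos M h <= mpos M k) || (hi M (c (opp k)) <= mpos M h).
    by have := mpos_gap Ms (opp k) h; rewrite oppK.
  have big h : h != k ->
      (mpos M h <= mpos M (opp (c (c k)))) || (hi M (c (opp k)) <= mpos M h).
    move=> hk; have /orP[->//|le1] := gap h; have /orP[le2|->] := gap' h; rewrite ?orbT //.
    by case/eqP: hk; apply: (mpos_inj Ms); apply/eqP; rewrite eq_le le1 le2.
  have mid_big h : h != c (c k) -> h != opp k ->
      (mid M h <= mpos M (opp (c (c k)))) || (hi M (c (opp k)) <= mid M h).
    move=> /(mid_gap Ms)[/ltW->//|]; rewrite (mccw3 Ms) (hi_nb M kb) => le1.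
    move=> /(mid_gap Ms)[|/ltW->]; rewrite ?orbT // oppK; lra.
  case: pos_g => [[-> [gk gk']]|->|->]; first exact: big.
  + by apply: mid_big; rewrite ?(inj_eq (mccw_inj Ms)) // eq_sym.
  + by apply: mid_big; rewrite // eq_sym (mccw_neq Ms).
- have [oc1 oc2] := opp_neq rk rk'.
  rewrite (pos'E oc1 oc2) (hi_nb M' kb) (hf_pos (fl_k F)).
  have /andP[m1 m2] := mid_bound Ms (c (opp k)).
  case: pos_g => [[-> _]|->|->].
  + by have /orP[le|le] := mpos_gap Ms (c (opp k)) g; apply/orP; [left|right]; lra.
  + by rewrite lexx orbT.
  + have [->|pr] := eqVneq (c k) (c (opp k)); first by rewrite lexx orbT.
    by have /orP[le|le] := gap_mid _ _ pr; apply/orP; [left|right]; lra.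
Qed.

(** If the side after [k] were glued to the side before [opp k], their common endpoint would be an
    interior vertex with two ends, around which positions would increase cyclically. Consequently
    the contributions to an entry of the exchange column never cancel. *)
Lemma half_disj (i : I) :
  c k \in val i -> (c (c k) \notin val i) && (c (c (opp k)) \notin val i).
Proof.
move=> /val_arc ->; rewrite !inE !negb_or.
rewrite (mccw_neq Ms) (mccw_opp Ms) (inj_eq (mccw_inj Ms)) rk /=.
apply/eqP => E; have [pb|pb] := eqVneq (c k) b.
  move: E; rewrite pb opp_b -pb => /(mccw_inj Ms) /eqP.
  by rewrite (negPf rk).
have := mpos_ccw Ms (c (c (opp k))); have := mpos_ccw Ms k.
rewrite (mccw3 Ms) E oppK !hi_nb // => lt1 lt2.
by have := lt_trans lt1 lt2; rewrite ltxx.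
Qed.

(** Matrix mutation localised at one side: as [exmat_mut] sums over the two sides of an arc, the
    product terms of the mutation rule are distributed over these sides. *)
Lemma half_mut (i i0 : I) x : k \in val i0 -> i != i0 -> x \in [:: c (c k); c (opp k)] ->
  (c' x \in val i)%:Z - (c' (c' x) \in val i)%:Z =
  (c x \in val i)%:Z - (c (c x) \in val i)%:Z
  + ((c k \in val i)%:Z + (c (opp k) \in val i)%:Z) * (c x \in val i0)%:Z
  - ((c (c k) \in val i)%:Z + (c (c (opp k)) \in val i)%:Z) * (c (c x) \in val i0)%:Z.
Proof.
move=> k0 ii0; have vi0 := val_arc k0.
have ki : (k \in val i) = false.
  by apply: contraNF ii0 => ki; apply/eqP/(arc_uniq ki k0).
have ki' : (opp k \in val i) = false.
  by rewrite -[opp k \in _]negbK; apply/negbF/negP => /opp_arc; rewrite oppK ki.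
rewrite !inE => /orP[] /eqP ->;
  rewrite ?(hf_c (fl_k F), hf_cq (fl_k F), hf_cr (fl_k F)) !(mccw3 Ms) ?ki ?ki' vi0 !inE
   ?eqxx ?orbT ?(negPf pk) ?(negPf pk') ?(negPf tk) ?(negPf tk') /=; ring.
Qed.

Lemma half_mut0 (i0 : I) x : k \in val i0 -> x \in [:: c (c k); c (opp k)] ->
  (c' x \in val i0)%:Z - (c' (c' x) \in val i0)%:Z =
  - ((c x \in val i0)%:Z - (c (c x) \in val i0)%:Z).
Proof.
move=> /val_arc ->.
rewrite !inE => /orP[] /eqP ->;
  by rewrite ?(hf_c (fl_k F), hf_cq (fl_k F), hf_cr (fl_k F)) !(mccw3 Ms)
   !eqxx ?orbT ?(negPf rk) ?(negPf rk') ?(negPf pk) ?(negPf pk') ?(negPf tk)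
   ?(negPf tk') ?(negPf qk) ?(negPf qk').
Qed.

Definition vif (a : bool) (e : vec) : vec := if a then e else 0.

(** The exponent [d] passes from the corner at the end of [x] to the corner at its start. The
    right-hand side of [exmat_frozen] thus changes by the sum of the [d] of the two sides, which is
    the correction term of the mutation. *)
Lemma half_frozen (i0 : I) x : k \in val i0 -> x \in [:: c (c k); c (opp k)] ->
  let d := vif (c x \in val i0) (vpos (flip_exp M k))
           - vif (c (c x) \in val i0) (vpos (- flip_exp M k)) in
  mZ M' (c' (c' x)) = mZ M (c (c x)) + d /\ mZ M' x = mZ M x - d.
Proof.
move=> /val_arc ->; rewrite /vif.
rewrite !inE => /orP[] /eqP ->;
  rewrite ?(hf_c (fl_k F), hf_cq (fl_k F), hf_cr (fl_k F)) !(mccw3 Ms)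
   ?eqxx ?orbT ?(negPf pk) ?(negPf pk') ?(negPf tk) ?(negPf tk') /=.
- by rewrite (hf_Z (fl_k F)) (hf_Zq (fl_k F)); split; vec_ring.
- rewrite (hf_Zr (fl_k F)) (hf_Zq (fl_k F)); split; last by vec_ring.
  by rewrite vposN /flip_exp; vec_ring.
Qed.

End Flipped.

Lemma quad_cases M k x :
  [\/ x \notin quad M k, x \in [:: k; mccw M (mccw M k); mccw M (opp k)]
    | x \in [:: opp k; mccw M (mccw M (opp k)); mccw M (opp (opp k))]].
Proof.
have [xq|xq] := boolP (x \in quad M k); last exact: Or31.
move: xq; rewrite oppK /quad !inE => /or4P[h|h|h|/or3P[h|h|h]];
  by [apply: Or32; rewrite h ?orbT | apply: Or33; rewrite h ?orbT].
Qed.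

Lemma arc_side (i : I) : exists h, h \in val i.
Proof. by have /imsetP[h _ ->] := valP i; exists h; rewrite !inE eqxx. Qed.

Lemma cluster_neq0 M s i : marked M s -> cluster s i != 0.
Proof. by move=> Ms; have [h hi] := arc_side i; rewrite -(mX_arc Ms hi) (mX_neq0 Ms). Qed.

Lemma prod_cluster M s h : marked M s ->
  \prod_i cluster s i ^ (h \in val i)%:Z = mX M h.
Proof.
move=> Ms; have [hb|hb] := boolP (h \in bdry O).
  rewrite big1 => [|i _]; last by rewrite arc_bdry.
  by move: hb; rewrite bdry_b inE => /eqP ->; rewrite (mX_b Ms).
have [i hi] := arc_ex hb.
rewrite (bigD1 i) //= hi expr1z (mX_arc Ms hi) big1 ?mulr1 // => j ji.
have [hj|//] := boolP (h \in val j).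
by rewrite (arc_uniq hi hj) eqxx in ji.
Qed.

Lemma posp_excl (m n : int) : 0 <= m -> 0 <= n -> m * n = 0 -> posp (m - n) = m.
Proof.
move=> m0 n0 /eqP; rewrite mulf_eq0 => /orP[] /eqP ->.
  by rewrite sub0r /posp max_r // oppr_le0.
by rewrite subr0 /posp max_l.
Qed.

(** * Flips realise mutations of the seed *)

Section FlipMarked.

Variables (M M' : marking) (s : seed I K) (k : O) (i0 : I).
Hypotheses (Ms : marked M s) (kb : k != b) (F : flipped M M' k) (k0 : k \in val i0).

Local Notation c := (mccw M).
Local Notation c' := (mccw M').
Local Notation e := (flip_exp M k).

Let oppkb : opp k != b. Proof. by rewrite opp_eqb. Qed.
Let F' := flipped_sym F.
Let k0' : opp k \in val i0. Proof. exact: opp_arc. Qed.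

Let inn (i : I) h : int := (h \in val i)%:Z.
Let out (i : I) := inn i (c k) + inn i (c (opp k)).
Let inc (i : I) := inn i (c (c k)) + inn i (c (c (opp k))).

Let out_inc i : out i * inc i = 0.
Proof.
have := half_disj Ms kb (i := i); have := half_disj Ms oppkb (i := i).
rewrite oppK /out /inc /inn.
case: (c k \in _) => [_ /(_ isT) /andP[/negPf-> /negPf->]|]; first by rewrite mulr0.
case: (c (opp k) \in _) => [/(_ isT) /andP[/negPf-> /negPf->]|]; by rewrite ?mulr0.
Qed.

Let posp_out i : posp (out i - inc i) = out i.
Proof. by apply: posp_excl; rewrite ?addr_ge0. Qed.

Let posp_inc i : posp (- (out i - inc i)) = inc i.
Proof. by rewrite opprB; apply: posp_excl; rewrite ?addr_ge0 // mulrC. Qed.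

Let b_k i : exmat s (inl i) i0 = out i - inc i.
Proof. by rewrite (exmat_mut Ms _ k0) /out /inc /inn; ring. Qed.

Let b_fk i : exmat s (inr i) i0 = e i.
Proof. by rewrite (exmat_frozen Ms _ k0). Qed.

Lemma mutate_cluster : cluster (mutate y s i0) i0 = flip_X M k.
Proof.
rewrite /= eqxx -(mX_arc Ms k0) /flip_X; congr (_ / _); rewrite !big_sumType /=.
congr (_ + _); rewrite mulrC -mulrA; congr (_ * _).
- by rewrite /ypow; apply: eq_bigr => i _; rewrite b_fk vposE.
- rewrite -!(prod_cluster _ Ms) -big_split /=; apply: eq_bigr => i _.
  by rewrite b_k posp_out expfzDr ?(cluster_neq0 _ Ms).
- by rewrite /ypow; apply: eq_bigr => i _; rewrite b_fk vposE [in RHS]ffunE.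
- rewrite -!(prod_cluster _ Ms) -big_split /=; apply: eq_bigr => i _.
  by rewrite b_k posp_inc expfzDr ?(cluster_neq0 _ Ms).
Qed.

Let from g := inn i0 (c g) + inn i0 (c (opp g)).
Let to g := inn i0 (c (c g)) + inn i0 (c (c (opp g))).

Let from_to (j : I) g : g \in val j -> from g * to g = 0.
Proof.
move=> gj; have gj' := opp_arc gj.
have hf x : x \in val j -> c x \in val i0 -> inc j != 0.
  rewrite (val_arc k0) !inE => xj /orP[] /eqP E; move: xj;
  by rewrite -(mccw3 Ms x) E /inc /inn => ->; case: (_ \in _).
have ht x : x \in val j -> c (c x) \in val i0 -> out j != 0.
  rewrite (val_arc k0) !inE => xj /orP[] /eqP E; move: xj;
  by rewrite -(mccw3 Ms x) E /out /inn => ->; case: (_ \in _).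
have := out_inc j => /eqP; rewrite mulf_eq0 => /orP[] /eqP E0.
  have {}ht x : x \in val j -> inn i0 (c (c x)) = 0.
    by move=> xj; rewrite /inn; case E: (_ \in _) => //; have := ht x xj E; rewrite E0 eqxx.
  by rewrite /to !ht // mulr0.
have {}hf x : x \in val j -> inn i0 (c x) = 0.
  by move=> xj; rewrite /inn; case E: (_ \in _) => //; have := hf x xj E; rewrite E0 eqxx.
by rewrite /from !hf // mul0r.
Qed.

Let b_kj (j : I) g : g \in val j -> exmat s (inl i0) j = from g - to g.
Proof. by move=> gj; rewrite (exmat_mut Ms _ gj) /from /to /inn; ring. Qed.

Let half_mem k1 x : k1 \in val i0 -> x \notin val i0 ->
  x \in [:: k1; c (c k1); c (opp k1)] -> x \in [:: c (c k1); c (opp k1)].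
Proof. by move=> k10 x0; rewrite !inE => /orP[/eqP E|//]; rewrite E k10 in x0. Qed.

Let quad_out x : x \notin quad M k -> inn i0 (c x) = 0 /\ inn i0 (c (c x)) = 0.
Proof.
move=> xq; have [_ _ cxq _ _] := fl_cat Ms F xq; have [_ _ _ h1 h2] := fl_cat Ms F cxq.
have [_ _ _ h3 h4] := fl_cat Ms F xq.
have [_ _ ccxq _ _] := fl_cat Ms F cxq.
move: cxq ccxq; rewrite /inn (val_arc k0) !inE !negb_or.
by case/and5P=> /negPf-> _ _ /negPf-> _ /and5P[/negPf-> _ _ /negPf-> _].
Qed.

Let side_mut i x : i != i0 -> x \notin val i0 ->
  inn i (c' x) - inn i (c' (c' x)) = inn i (c x) - inn i (c (c x))
    + out i * inn i0 (c x) - inc i * inn i0 (c (c x)).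
Proof.
move=> ii0 x0; have [xq|xq|xq] := quad_cases M k x.
- have [-> _ cxq _ _] := fl_cat Ms F xq; have [-> _ _ _ _] := fl_cat Ms F cxq.
  by have [-> ->] := quad_out xq; rewrite !mulr0 addr0 subr0.
- exact: (half_mut Ms F k0 ii0 (half_mem k0 x0 xq)).
- have := half_mut Ms F' k0' ii0 (half_mem k0' x0 xq).
  by rewrite oppK /out /inc ![_ + inn _ (c (opp k))]addrC ![_ + inn _ (c (c (opp k)))]addrC.
Qed.

Let side_mut0 x : x \notin val i0 ->
  inn i0 (c' x) - inn i0 (c' (c' x)) = - (inn i0 (c x) - inn i0 (c (c x))).
Proof.
move=> x0; have [xq|xq|xq] := quad_cases M k x.
- have [-> _ cxq _ _] := fl_cat Ms F xq; have [-> _ _ _ _] := fl_cat Ms F cxq.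
  by have [-> ->] := quad_out xq.
- exact: (half_mut0 Ms F k0 (half_mem k0 x0 xq)).
- exact: (half_mut0 Ms F' k0' (half_mem k0' x0 xq)).
Qed.

Let side_frozen x : x \notin val i0 ->
  let d := vif (c x \in val i0) (vpos e) - vif (c (c x) \in val i0) (vpos (- e)) in
  mZ M' (c' (c' x)) = mZ M (c (c x)) + d /\ mZ M' x = mZ M x - d.
Proof.
move=> x0; have [xq|xq|xq] := quad_cases M k x.
- have [-> -> cxq _ _] := fl_cat Ms F xq; have [-> _ ccxq _ _] := fl_cat Ms F cxq.
  have [_ -> _ _ _] := fl_cat Ms F ccxq.
  have := quad_out xq; rewrite /inn.
  by case: (_ \in _) => -[] //; case: (_ \in _) => // _ _; rewrite /= subr0 addr0 subr0.
- exact: (half_frozen Ms F k0 (half_mem k0 x0 xq)).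
- have := half_frozen Ms F' k0' (half_mem k0' x0 xq).
  by rewrite (flip_exp_opp _ Ms).
Qed.

Let hcases h : h \notin quad M k \/ exists k1,
  [/\ k1 != b, flipped M M' k1 & h \in [:: k1; c (c k1); c (opp k1)]].
Proof.
case: (quad_cases M k h) => hq; [by left|right|right]; first by exists k.
by exists (opp k).
Qed.

Let new_or_old h : (h = k \/ h = opp k) \/ (h != k /\ h != opp k).
Proof.
have [->|hk] := eqVneq h k; first by left; left.
by have [->|hk'] := eqVneq h (opp k); [left; right|right].
Qed.

Let X'k : mX M' k = flip_X M k. Proof. exact: hf_X (fl_k F). Qed.
Let X'k' : mX M' (opp k) = flip_X M k.
Proof. by rewrite (hf_X (fl_k' F)) (flip_X_opp _ Ms). Qed.

Let pos'k : mpos M' k = mid M (c (opp k)). Proof. exact: hf_pos (fl_k F). Qed.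
Let pos'k' : mpos M' (opp k) = mid M (c k).
Proof. by rewrite (hf_pos (fl_k' F)) oppK. Qed.

Let notin_arc (j : I) g : g \in val j -> j != i0 -> g \notin val i0.
Proof. by move=> gj; apply: contra => gi0; rewrite (arc_uniq gj gi0). Qed.

Let pos_old x h : x != k -> x != opp k -> mpos M' x != mid M h.
Proof. by move=> h1 h2; case: (fl_X F h1 h2) => _ _ _ ->; rewrite eq_sym (mid_neq Ms). Qed.

Let mid_inj g h : mid M g = mid M h -> g = h.
Proof.
move=> E; apply/eqP; apply: contraT => gh.
have /andP[m1 m2] := mid_bound Ms h.
by have [] := mid_gap Ms gh; rewrite E => m3; lra.
Qed.

(** Outside the quadrilateral nothing moves; on a new triangle the lemmas on half flips apply to [k]
    or to [opp k]. *)
Lemma flip_marked : marked M' (mutate y s i0).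
Proof.
have bk : b != k by rewrite eq_sym.
have bk' : b != opp k by rewrite eq_sym.
have [Xb Sb _ posb] := fl_X F bk bk'.
split.
- move=> h; have [hq|[k1 [k1b F1 hq]]] := hcases h.
    by have [-> _ _ _ _] := fl_cat Ms F hq; apply: mccw_neq Ms _.
  have [h1 h2 h3] := half_ccw_neq Ms F1.
  by move: hq; rewrite !inE => /or3P[] /eqP->.
- move=> h; have [hq|[k1 [k1b F1 hq]]] := hcases h; last exact: (half_ccw3 F1 hq).
  have [-> _ hq' _ _] := fl_cat Ms F hq; have [-> _ hq'' _ _] := fl_cat Ms F hq'.
  by have [-> _ _ _ _] := fl_cat Ms F hq''; apply: mccw3 Ms _.
- by rewrite Xb (mX_b Ms).
- move=> i h hi; have [hk|[h1 h2]] := new_or_old h.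
    have h0 : h \in val i0 by case: hk => ->.
    by rewrite (arc_uniq hi h0) mutate_cluster; case: hk => ->.
  have [-> _ _ _] := fl_X F h1 h2; rewrite (mX_arc Ms hi) /= ifN //.
  apply: contraNneq h1 => E; move: hi; rewrite E (val_arc k0) !inE.
  by rewrite (negPf h2) orbF.
- move=> h; have [[->|->]|[h1 h2]] := new_or_old h.
  + by rewrite X'k; apply: flip_X_val Ms.
  + by rewrite X'k'; apply: flip_X_val Ms.
  + by have [-> _ _ _] := fl_X F h1 h2; apply: mX_val Ms _.
- by rewrite Sb (mS_b Ms).
- move=> h; have [hq|[k1 [k1b F1 hq]]] := hcases h; last exact: (half_S Ms k1b F1 hq).
  have [-> -> hq' h1 h2] := fl_cat Ms F hq.
  have [-> _ hq'' h3 h4] := fl_cat Ms F hq'; have [_ _ _ h5 h6] := fl_cat Ms F hq''.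
  have h7 : opp h != k by rewrite -[k]oppK (inj_eq (inv_inj (@oppK O))).
  have h8 : opp h != opp k by rewrite (inj_eq (inv_inj (@oppK O))).
  have [-> _ _ _] := fl_X F h1 h2; have [-> E _ _] := fl_X F h3 h4.
  have [-> _ _ _] := fl_X F h5 h6; have [_ -> _ _] := fl_X F h7 h8.
  by rewrite /Shi E -(mS_ccw Ms).
- move=> h; have [hq|[k1 [k1b F1 hq]]] := hcases h; last exact: (half_Z_mm Ms F1 hq).
  have [-> -> hq' h1 h2] := fl_cat Ms F hq.
  have [-> _ hq'' h3 h4] := fl_cat Ms F hq'; have [_ -> _ h5 h6] := fl_cat Ms F hq''.
  by have [_ _ -> _] := fl_X F h1 h2; rewrite (mZ_mm Ms).
- have Ek : mm M' (opp k) = mm M' k.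
    rewrite (hf_m (fl_k F)) (hf_m (fl_k' F)) oppK (flip_exp_opp _ Ms).
    by rewrite [mZ M _ + mZ M _]addrC.
  move=> h; have [[->|->]|[h1 h2]] := new_or_old h; rewrite ?oppK //.
  have h7 : opp h != k by rewrite -[k]oppK (inj_eq (inv_inj (@oppK O))).
  have h8 : opp h != opp k by rewrite (inj_eq (inv_inj (@oppK O))).
  have [_ _ -> _] := fl_X F h1 h2; have [_ _ -> _] := fl_X F h7 h8.
  exact: mm_opp Ms _.
- by rewrite posb (mpos_b Ms).
- have mid0 h : 0 < mid M h.
    by have /andP[m1 _] := mid_bound Ms h; apply: le_lt_trans m1; apply: mpos_ge0 Ms _.
  move=> h hb; have [[->|->]|[h1 h2]] := new_or_old h; rewrite ?pos'k ?pos'k' //.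
  by have [_ _ _ ->] := fl_X F h1 h2; apply: mpos_gt0 Ms _ hb.
- have mid1 h : mid M h < 1.
    by have /andP[_ m1] := mid_bound Ms h; apply: lt_le_trans m1 _; apply: hi_le1 Ms _.
  move=> h; have [[->|->]|[h1 h2]] := new_or_old h; rewrite ?pos'k ?pos'k' //.
  by have [_ _ _ ->] := fl_X F h1 h2; apply: mpos_lt1 Ms _.
- have cinj := mccw_inj Ms.
  move=> h g; have [hk|[h1 h2]] := new_or_old h; have [gk|[g1 g2]] := new_or_old g.
  + case: hk gk => -> [] ->; rewrite ?pos'k ?pos'k' //.
      by move/mid_inj/cinj.
    by move/mid_inj/cinj.
  + by case: hk => ->; rewrite ?pos'k ?pos'k' => /esym/eqP; rewrite (negPf (pos_old _ g1 g2)).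
  + by case: gk => ->; rewrite ?pos'k ?pos'k' => /eqP; rewrite (negPf (pos_old _ h1 h2)).
  + have [_ _ _ ->] := fl_X F h1 h2; have [_ _ _ ->] := fl_X F g1 g2.
    exact: mpos_inj Ms _ _.
- move=> h; have [hq|[k1 [k1b F1 hq]]] := hcases h; last exact: (half_pos Ms k1b F1 hq).
  have [-> _ hq' h1 h2] := fl_cat Ms F hq; have [_ _ hq'' h3 h4] := fl_cat Ms F hq'.
  have h7 : opp h != k by rewrite -[k]oppK (inj_eq (inv_inj (@oppK O))).
  have h8 : opp h != opp k by rewrite (inj_eq (inv_inj (@oppK O))).
  have [_ _ _ ->] := fl_X F h7 h8; have [_ _ _ E] := fl_X F h3 h4.
  by rewrite /hi E; apply: mpos_ccw Ms h.
- move=> h g; have [hq|[k1 [k1b F1 hq]]] := hcases h; last exact: (half_gap Ms k1b F1 g hq).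
  have [-> _ hq' h1 h2] := fl_cat Ms F hq; have [_ _ hq'' h3 h4] := fl_cat Ms F hq'.
  have h7 : opp h != k by rewrite -[k]oppK (inj_eq (inv_inj (@oppK O))).
  have h8 : opp h != opp k by rewrite (inj_eq (inv_inj (@oppK O))).
  have [_ _ _ ->] := fl_X F h7 h8; have [_ _ _ E] := fl_X F h3 h4.
  rewrite {1}/hi E -/(hi M (mccw M h)).
  have gap_mid a : a != h ->
      (mid M a <= mpos M (opp h)) || (hi M (c h) <= mid M a).
    by move=> /(mid_gap Ms)[/ltW->|/ltW->]; rewrite ?orbT.
  move: hq; rewrite /quad !inE !negb_or => /and5P[_ _ hr _ /andP[_ hp]].
  have [[->|->]|[g1 g2]] := new_or_old g.
  + by rewrite pos'k gap_mid // eq_sym.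
  + by rewrite pos'k' gap_mid // eq_sym.
  + by have [_ _ _ ->] := fl_X F g1 g2; apply: mpos_gap Ms h g.
(* In the column of the flipped arc, successors and predecessors are exchanged; any other column is
   the sum of [side_mut] over the two sides of its arc. *)
- move=> i j g gj; have [ji0|ji0] := eqVneq j i0.
    rewrite /= ji0 eqxx orbT b_k; rewrite ji0 (val_arc k0) !inE in gj.
    have Hk := fl_k F; have Hk' := fl_k' F; have Ek := hf_cq Hk'; rewrite oppK in Ek.
    case/orP: gj => /eqP->; rewrite ?oppK (hf_c Hk) (hf_c Hk') (hf_cq Hk) Ek;
    rewrite /out /inc /inn; ring.
  have g0 := notin_arc gj ji0; have g0' := notin_arc (opp_arc gj) ji0.
  have -> : exmat (mutate y s i0) (inl i) j =
      if i == i0 then - exmat s (inl i) j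
      else exmat s (inl i) j + posp (exmat s (inl i) i0) * posp (exmat s (inl i0) j)
           - posp (- exmat s (inl i) i0) * posp (- exmat s (inl i0) j).
    by rewrite /= (negPf ji0) orbF.
  case: eqVneq => [->|ii0].
    have := side_mut0 g0; have := side_mut0 g0'; rewrite (b_kj gj) /from /to /inn.
    by move=> E1 E2; rewrite -[RHS]addrA E1 E2; ring.
  have := side_mut ii0 g0; have := side_mut ii0 g0'; rewrite /inn => E1 E2.
  rewrite -[RHS]addrA E1 E2 b_k posp_out posp_inc (b_kj gj).
  have from0 : 0 <= from g by rewrite addr_ge0.
  have to0 : 0 <= to g by rewrite addr_ge0.
  have ft := from_to gj; rewrite (posp_excl from0 to0 ft) opprB posp_excl 1?mulrC //.
  by rewrite (exmat_mut Ms _ gj) /from /to /inn; ring.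
- move=> i j g gj; have [ji0|ji0] := eqVneq j i0.
    rewrite /= ji0 eqxx ?orbT b_fk; rewrite ji0 (val_arc k0) !inE in gj.
    have Hk := fl_k F; have Hk' := fl_k' F; have Ek := hf_cq Hk'; rewrite oppK in Ek.
    have Er := hf_Zr Hk'; rewrite oppK in Er.
    case/orP: gj => /eqP->; rewrite ?oppK (hf_c Hk, hf_c Hk') (hf_cq Hk, Ek).
      rewrite (hf_Zr Hk) (hf_Z Hk') (flip_exp_opp _ Ms) vposN !ffunE; ring.
    rewrite Er (hf_Z Hk) (flip_exp_opp _ Ms) vposN !ffunE; ring.
  have g0 := notin_arc gj ji0; have g0' := notin_arc (opp_arc gj) ji0.
  have -> : exmat (mutate y s i0) (inr i) j =
      exmat s (inr i) j + posp (exmat s (inr i) i0) * posp (exmat s (inl i0) j)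
           - posp (- exmat s (inr i) i0) * posp (- exmat s (inl i0) j).
    by rewrite /= (negPf ji0).
  have from0 : 0 <= from g by rewrite addr_ge0.
  have to0 : 0 <= to g by rewrite addr_ge0.
  have ft := from_to gj; rewrite b_fk (b_kj gj) (posp_excl from0 to0 ft) opprB.
  rewrite (posp_excl to0 from0) 1?mulrC //.
  have [-> _] := side_frozen g0; have [_ ->] := side_frozen g0'.
  rewrite (exmat_frozen Ms _ gj) /from /to /inn.
  have vifE a u : vif a u i = a%:Z * u i.
    by case: a; rewrite ?mul1r // mul0r /vif ffunE.
  move: (vpos e) (vpos (- e)) (vposE e i) (vposE (- e) i) => u v <-.
  rewrite [(- e) i]ffunE => <-.
  by rewrite !(ffunE, vifE); ring.
Qed.

End FlipMarked.

End Marking.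

(** * Fans, and the ends of arcs in the cluster algebra *)

Lemma twist_identity (F : fieldType) (xv xw sv' yb yv : F) : xv != 0 -> xw != 0 ->
  xv * (yb * xw / xv) * sv' + yv * yb / xv = yb * (xw * (sv' + yv / (xv * xw))).
Proof. by move=> v0 w0; field; rewrite v0 w0. Qed.

Lemma triangle_identity (F : fieldType) (xu xv xa su sv yu yv : F) :
  [&& xu != 0, xv != 0 & xa != 0] ->
  xu * (xv * (su + yu * xa / (xu * xv)) * sv + yv * yu / xv)
  = (xu * su) * (xv * sv) + yu * xa * (sv + yv * xu / (xv * xa)).
Proof. by case/and3P=> u0 v0 a0; field; rewrite u0 v0 a0. Qed.

Lemma crossing_identity (F : fieldType) (xu xv xe su sv su' se' yu ye : F) :
  [&& xu != 0, xv != 0 & xe != 0] ->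
  sv = su + yu * xe / (xu * xv) -> su' = se' + ye * xv / (xe * xu) ->
  (xu * su') * (xv * sv) = xv * (xu * su * su' + yu * ye / xu) + yu * (xe * se').
Proof. by case/and3P=> u0 v0 e0 -> ->; field; rewrite u0 v0 e0. Qed.

(** * Elements of the algebra up to monomials in the coefficients *)

Section Reachable.

Variables (O : orbifold) (K : fieldType).

Local Notation I := (arc O).
Local Notation vec := {ffun I -> int}.

Variables (y : I -> K) (hv : K -> vec -> Prop).
Hypothesis V : valuation y hv.

Variables (b : O) (f : K).
Hypothesis bdry_b : bdry O = [set b].

Variable s0 : seed I K.

Local Notation A := (cluster_algebra y s0).
Local Notation marked := (marked y hv b f).

Lemma A0 : A 0.
Proof. by rewrite -(subrr 1); apply: gen_sub; apply: gen_one. Qed.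

Lemma A_ypow (e : vec) : (forall i, 0 <= e i) -> A (ypow y e).
Proof.
move=> e0; rewrite /ypow; elim/big_ind: _ => [|z t Az At|i _].
- exact: gen_one.
- exact: gen_mul.
have [n ->] : exists n : nat, e i = n by exists `|e i|%N; rewrite gez0_abs.
rewrite -exprnP; elim: n => [|n IHn]; first exact: gen_one.
by rewrite exprS; apply: gen_mul IHn; apply: gen_in; right; exists i.
Qed.

Definition reachable (s : seed I K) : Prop := exists ks, s = foldl (mutate y) s0 ks.

Lemma reachable_mutate s i : reachable s -> reachable (mutate y s i).
Proof. by move=> [ks ->]; exists (rcons ks i); rewrite foldl_rcons. Qed.

Definition vle (e e' : vec) : Prop := forall i, e i <= e' i.

(* [z] divided by the largest monomial in the coefficients is in [A]. *)
Definition primA (z : K) : Prop :=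
  exists e g, [/\ z = ypow y e * g, hv g 0 & A g].

(** The exponent is prescribed and may be smaller than the valuation; this makes the notion stable
    under subtraction, unlike [primA]. *)
Definition divA (e : vec) (z : K) : Prop := exists2 g, z = ypow y e * g & A g.

Lemma primA_hv z : primA z -> exists e, hv z e.
Proof.
by move=> [e [g [-> g0 _]]]; exists (e + 0); apply: (hv_mul V) => //; apply: hv_ypow V _.
Qed.

Lemma primAM z t : primA z -> primA t -> primA (z * t).
Proof.
move=> [e [g [-> g0 Ag]]] [e' [g' [-> g0' Ag']]]; exists (e + e'), (g * g').
split; [by rewrite (ypowD V) mulrACA | by rewrite -[0]addr0; apply: (hv_mul V)
  | exact: gen_mul].
Qed.

Lemma primA_ypow e z : primA z -> primA (ypow y e * z).
Proof.
by move=> [e' [g [-> g0 Ag]]]; exists (e + e'), g; rewrite (ypowD V) mulrA.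
Qed.

Lemma primA_ypow_inv e z : primA (ypow y e * z) -> primA z.
Proof.
by move=> /(primA_ypow (- e)); rewrite mulrA -(ypowD V) addNr ypow0 mul1r.
Qed.

Lemma primA_divA e e' z : primA z -> hv z e -> vle e' e -> divA e' z.
Proof.
move=> [e1 [g [-> g0 Ag]]] ze le; exists (ypow y (e1 - e') * g).
  by rewrite mulrA -(ypowD V) addrC subrK.
apply: gen_mul Ag; apply: A_ypow => i.
have := hv_uniq V ze (hv_mul V (hv_ypow V e1) g0); rewrite addr0 => <-.
by rewrite !ffunE subr_ge0.
Qed.

Lemma divA_primA e z : divA e z -> hv z e -> primA z.
Proof.
move=> [g -> Ag] ze; exists e, g; split=> //.
have := hv_mul V (hv_ypow V (- e)) ze.
by rewrite mulrA -(ypowD V) addNr ypow0 mul1r.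
Qed.

Lemma divAB e z t : divA e z -> divA e t -> divA e (z - t).
Proof.
by move=> [g -> Ag] [g' -> Ag']; exists (g - g'); [rewrite mulrBr|apply: gen_sub].
Qed.

Lemma primA_X M s h : marked M s -> reachable s -> primA (mX M h).
Proof.
move=> Ms [ks Es]; exists 0, (mX M h); rewrite ypow0 mul1r; split=> //.
  exact: mX_val Ms h.
have [hb|hb] := boolP (h \in bdry O).
  by move: hb; rewrite bdry_b inE => /eqP->; rewrite (mX_b Ms); apply: gen_one.
have [i hi] := arc_ex hb; rewrite (mX_arc Ms hi); apply: gen_in; left.
by exists ks, i; rewrite Es.
Qed.

(** * Making two ends adjacent by flips *)

Definition same_at (M M' : marking O K) (h : O) : Prop :=
  [/\ mX M' h = mX M h, mS M' h = mS M h, mm M' h = mm M h & mpos M' h = mpos M h].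

Definition between (M : marking O K) (g h : O) : {set O} :=
  [set x | mpos M g < mpos M x < mpos M h].

Lemma double_lt (m n : nat) (p q : bool) : (m < n)%N -> (2 * m + p < 2 * n + q)%N.
Proof. by case: p; case: q => /=; lia. Qed.

(* The measure counts the ends between [g] and [h].  Flipping the end [k] next to
   [g] lowers it, unless the new diagonal has an end between [g] and [h]; then the
   second term decreases, and the next flip removes an end. *)
Lemma fan_step M s g h (c := mccw M) : marked M s -> reachable s ->
  mpos M g < mpos M h ->
  ~~ (mpos M g < mpos M (opp g) <= mpos M h) ->
  ~~ (mpos M g <= mpos M (opp h) < mpos M h) ->
  mccw M (opp g) != h ->
  exists M' s', [/\ marked M' s', reachable s',
    (forall x, x \in [:: g; opp g; h; opp h] -> same_at M M' x)
    & (2 * #|between M' g h| + (opp (mccw M' (opp g)) \notin between M' g h) <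
       2 * #|between M g h| + (opp (mccw M (opp g)) \notin between M g h))%N].
Proof.
move=> Ms Rs gh cg ch; set k := mccw M (opp g) => kh.
have cinj := mccw_inj Ms; have pinj := mpos_inj Ms.
have gk : mpos M g < hi b M k by have := mpos_ccw Ms (opp g); rewrite oppK.
have kh1 : hi b M k <= mpos M h.
  by have := mpos_gap Ms (opp g) h; rewrite oppK => /orP[le|//]; lra.
have kb : k != b.
  by apply: contraTneq kh1 => ->; rewrite /hi eqxx -ltNge (mpos_lt1 Ms).
rewrite hi_nb // in gk kh1.
have {}kh1 : mpos M k < mpos M h by rewrite lt_neqAle kh1 (inj_eq pinj) kh.
have qE : mccw M (mccw M k) = opp g by rewrite (mccw3 Ms).
have [i0 k0] : exists i : I, k \in val i by apply: arc_ex; rewrite bdry_b inE.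
have F := flipP bdry_b k Ms; set M' := flip _ _ _ _ in F.
have Ms' := flip_marked V bdry_b Ms kb F k0.
have neq x : x \in [:: g; opp g; h; opp h] -> x != k /\ x != opp k.
  have neq1 z : z \in [:: g; opp g; h; opp h] -> z != k.
    rewrite !inE => /or4P[] /eqP->; apply/negP => /eqP E.
    - by rewrite E ltxx in gk.
    - by move: cg; rewrite E gk ltW.
    - by case/eqP: kh.
    - by move: ch; rewrite E kh1 ltW.
  move=> xin; split; first exact: neq1.
  rewrite -[x]oppK (inj_eq (inv_inj (@oppK O))); apply: neq1.
  by move: xin; rewrite !inE => /or4P[] /eqP->; rewrite ?oppK eqxx ?orbT.
exists M', (mutate y s i0); split=> //; first exact: reachable_mutate.
  by move=> x xin; apply: (fl_X F); case: (neq x xin).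
have kk' : c k != opp k := mccw_opp bdry_b Ms k.
have turn' : mccw M' (opp g) = c (opp k) by rewrite -qE (hf_cq (fl_k F)).
have pos_old x : x != k -> x != opp k -> mpos M' x = mpos M x.
  by move=> h1 h2; have [] := fl_X F h1 h2.
have g_old : mpos M' g = mpos M g by apply: pos_old; case: (neq g) => //; rewrite inE eqxx.
have h_old : mpos M' h = mpos M h.
  by apply: pos_old; case: (neq h) => //; rewrite !inE eqxx ?orbT.
have old x : x != k -> x != opp k -> (x \in between M' g h) = (x \in between M g h).
  by move=> h1 h2; rewrite !inE g_old h_old pos_old.
have kB : k \in between M g h by rewrite inE gk.
(* The end [opp k] of the new diagonal lands just before [opp g], which [cg] keeps away from the
   interval. *)
have k'B : opp k \notin between M' g h.
  rewrite inE g_old h_old (hf_pos (fl_k' F)) oppK; apply/negP => /andP[m1 m2].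
  have /andP[m3 m4] := mid_bound Ms (c k).
  have /orP[le|le] := mpos_gap Ms (c k) h; first lra.
  move: m4 le; rewrite qE => m4 le.
  have gb : opp g != b.
    by apply: contraTneq le => ->; rewrite /hi eqxx -ltNge (mpos_lt1 Ms).
  by rewrite hi_nb // in m4 le; move/negP: cg; apply; rewrite le (lt_trans m1).
have rB : k \in between M' g h -> opp (c (opp k)) \in between M g h.
  rewrite !inE g_old h_old (hf_pos (fl_k F)) => /andP[m1 m2].
  have /andP[m3 m4] := mid_bound Ms (c (opp k)).
  rewrite (lt_trans m3 m2) andbT lt_neqAle; apply/andP; split.
    rewrite (inj_eq pinj); apply: contra kk' => /eqP E; apply/eqP/cinj.
    by rewrite /c qE E oppK.
  by have /orP[//|le] := mpos_gap Ms (c (opp k)) g; lra.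
have sub x : x \in between M' g h -> x != k -> x \in between M g h.
  move=> xB xk; rewrite -old //; apply: contraNneq k'B => <-; exact: xB.
rewrite turn'; have [kB'|kB'] := boolP (k \in between M' g h); last first.
  apply/double_lt/proper_card/properP; split; last by exists k.
  by apply/subsetP => x xB; apply: sub => //; apply: contraNneq kB' => <-.
have kk'1 : opp k != k by apply: contraNneq k'B => ->.
have subB : between M' g h \subset between M g h.
  by apply/subsetP => x xB; have [->//|] := eqVneq x k; apply: sub.
(* If [opp k] was in the interval, it has left it. Otherwise the count may be unchanged, but the arc
   now next to [g] has its other end in the interval, which lowers the second term. *)
have [k'B0|k'B0] := boolP (opp k \in between M g h).
  by apply/double_lt/proper_card/properP; split=> //; exists (opp k).
have -> : opp (c (opp k)) \in between M' g h.
  rewrite old ?rB //; last first.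
    by rewrite (inj_eq (inv_inj (@oppK O))); have := mccw_opp bdry_b Ms (opp k); rewrite oppK.
  by rewrite -{2}[k]oppK (inj_eq (inv_inj (@oppK O))) (mccw_neq Ms).
by rewrite /= addn0 addn1 ltnS leq_mul2l subset_leq_card.
Qed.

(** Clears the interval from [g] to [h], so that both become sides of one triangle. The arcs of [g]
    and [h] must survive the flips, hence the conditions that their other ends lie outside the
    interval; a pending arc satisfies them. *)
Lemma fan M s g h : marked M s -> reachable s ->
  mpos M g < mpos M h ->
  ~~ (mpos M g < mpos M (opp g) <= mpos M h) ->
  ~~ (mpos M g <= mpos M (opp h) < mpos M h) ->
  exists M' s', [/\ marked M' s', reachable s', mccw M' (opp g) = h
    & forall x, x \in [:: g; opp g; h; opp h] -> same_at M M' x].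
Proof.
have [n] := ubnP (2 * #|between M g h| + (opp (mccw M (opp g)) \notin between M g h)).
elim: n M s => // n IHn M s /ltnSE le_n Ms Rs gh cg ch.
have [kh|kh] := eqVneq (mccw M (opp g)) h.
  by exists M, s; split.
have [M1 [s1 [Ms1 Rs1 same1 lt_n]]] := fan_step Ms Rs gh cg ch kh.
have pos1 x : x \in [:: g; opp g; h; opp h] -> mpos M1 x = mpos M x.
  by case/same1.
have [|||M2 [s2 [Ms2 Rs2 E2 same2]]] := IHn M1 s1 (leq_trans lt_n le_n) Ms1 Rs1.
- by rewrite !pos1 // !inE eqxx ?orbT.
- by rewrite !pos1 // !inE eqxx ?orbT.
- by rewrite !pos1 // !inE eqxx ?orbT.
exists M2, s2; split=> // x xin.
by rewrite /same_at; have [-> -> -> ->] := same2 x xin; apply: same1.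
Qed.

Lemma first_end M s h : marked M s -> reachable s -> h != b ->
  mpos M h <= mpos M (opp h) -> primA (mX M h * mS M h).
Proof.
move=> Ms Rs hb hfirst; have posb := mpos_b Ms; have h0 := mpos_gt0 Ms hb.
have [|||M' [s' [Ms' Rs' E same]]] := fan Ms Rs (g := b) (h := h).
- by rewrite posb.
- by rewrite (opp_b bdry_b) ltxx.
- by rewrite posb [_ < mpos M h]ltNge hfirst andbF.
have [eX eS _ _] : same_at M M' h by apply: same; rewrite !inE eqxx ?orbT.
have := mS_ccw Ms' (opp b); rewrite E Shi_nb // oppK (mS_b Ms') add0r (opp_b bdry_b).
rewrite (mX_b Ms') mul1r -eS -eX => ->.
rewrite mulrC divfK ?(mX_neq0 V Ms') //.
by apply: primA_ypow; apply: primA_X Ms' Rs'.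
Qed.

(* If [v] is the first end of its arc, then [mX M v * mS M v] is up to a monomial
   the variable of the arc obtained by dragging [v] once around the boundary
   component, and [double_twist M v] that obtained by dragging both ends. *)
Definition double_twist (M : marking O K) (v : O) : K :=
  mX M v * mS M v * mS M (opp v) + ypow y (mm M v) / mX M v.

Lemma double_twist_opp M s v : marked M s -> double_twist M (opp v) = double_twist M v.
Proof.
move=> Ms; rewrite /double_twist oppK (mm_opp Ms) (mX_opp Ms).
by rewrite -!mulrA [mS M v * _]mulrC.
Qed.

(** When the first end [v] is next to [b], let [w] be the third side of their triangle: dragging
    both ends of [v] amounts, up to a monomial, to dragging the first end of [w]. *)
Lemma double_twistP M s v : marked M s -> reachable s -> v != b ->
  primA (double_twist M v).
Proof.
wlog vfirst : v / mpos M v <= mpos M (opp v).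
  move=> th Ms Rs vb; have /orP[le|le] := le_total (mpos M v) (mpos M (opp v)).
    exact: th.
  rewrite -(double_twist_opp _ Ms); apply: th => //; first by rewrite oppK.
  by rewrite (opp_eqb bdry_b).
move=> Ms Rs vb; have posb := mpos_b Ms; have v0 := mpos_gt0 Ms vb.
have [|||M' [s' [Ms' Rs' E same]]] := fan Ms Rs (g := b) (h := v).
- by rewrite posb.
- by rewrite (opp_b bdry_b) ltxx.
- by rewrite posb [_ < mpos M v]ltNge vfirst andbF.
have [eX eS em _] : same_at M M' v by apply: same; rewrite !inE eqxx ?orbT.
have [_ eS' _ _] : same_at M M' (opp v) by apply: same; rewrite !inE eqxx ?orbT.
rewrite (opp_b bdry_b) in E; pose w := mccw M' v.
have wb : mccw M' w = b by rewrite /w -E (mccw3 Ms').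
have w_b : w != b by apply: contraTneq (mccw_neq Ms' w) => wb'; rewrite wb wb' eqxx.
have ov : opp b = b := opp_b bdry_b.
have Sv := mS_ccw Ms' b; rewrite E Shi_nb // ov (mS_b Ms') add0r (mX_b Ms') mul1r in Sv.
have Sw := mS_ccw Ms' v; rewrite -/w Shi_nb // wb (mX_b Ms') mulr1 in Sw.
have mv : mm M' v = mZ M' v + mZ M' b by rewrite -(mZ_mm Ms') -/w wb.
have -> : double_twist M v = ypow y (mZ M' b) * (mX M' w * mS M' w).
  rewrite /double_twist -eX -eS -eS' -em mv Sv Sw (ypowD V).
  by apply: twist_identity; rewrite (mX_neq0 V Ms').
apply: primA_ypow; apply: (first_end Ms' Rs' w_b).
(* The corner following [opp w] closes the cycle at [b], so [opp w] is the last of all ends. *)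
by have := mpos_gap Ms' w w; rewrite wb /hi eqxx => /orP[//|]; rewrite leNgt (mpos_lt1 Ms').
Qed.

(** * Induction along the ends of the initial triangulation *)

Section Initial.

Variable M : marking O K.
(** Exponents decrease around the marked point: [ge_exp] compares the corners before and after an
    end, and by [val_Shi] the last corner of a partial sum gives its valuation. *)
Hypotheses (Ms : marked M s0) (val_Shi : forall h, hv (Shi b f M (mccw M h)) (mZ M h)).
Hypothesis ge_exp : forall h, h != b -> vle (mZ M (opp h)) (mZ M (mccw M (mccw M h))).

Local Notation c := (mccw M).

Let Rs : reachable s0. Proof. by exists [::]. Qed.

Let val_S h : h != b -> hv (mS M h) (mZ M (c (c h))).
Proof. by move=> hb; rewrite -(Shi_nb f M hb) -{1}(mccw3 Ms h). Qed.

(* With [u], [v] the other sides of the triangle of [a], the relation [ET] reads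
   [X(u) * double_twist(v) = z2 + T], where [T] is the wanted element up to a
   monomial.  If the end [opp u] comes before [a], then the factors of [z2] are
   known by induction; otherwise the fan from [u] to [opp v] resolves the crossing
   in [z2]. *)
Lemma end_primA a : primA (mX M a * Shi b f M a).
Proof.
(* The last occurrence of [a] is meant: for [a = b], all ends come before it. *)
have [n] := ubnP #|[set x | mpos M x < hi b M a]|.
elim: n a => // n IHn a /ltnSE le_n.
have posb := mpos_b Ms; have pinj := mpos_inj Ms.
have oppb := opp_eqb bdry_b.
have [/andP[ab afirst]|] := boolP ((a != b) && (mpos M a <= mpos M (opp a))).
  by rewrite Shi_nb //; apply: first_end Ms Rs ab afirst.
rewrite negb_and negbK -ltNge => alast.
pose u := c a; pose v := c u.
have cv : c v = a by rewrite /v /u (mccw3 Ms).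
have ltu : mpos M (opp a) < hi b M u := mpos_ccw Ms a.
have ltv : mpos M (opp u) < hi b M v := mpos_ccw Ms u.
have lta : mpos M (opp v) < hi b M a by have := mpos_ccw Ms v; rewrite cv.
have last_b h x : c h = b -> mpos M x <= mpos M (opp h).
  move=> hb; have := mpos_gap Ms h x; rewrite hb /hi eqxx.
  by rewrite [1 <= _]leNgt (mpos_lt1 Ms) orbF.
have ub : u != b.
  apply/eqP => ub; have := last_b a a ub; case/orP: alast => [/eqP ab|]; last lra.
  by have := mccw_neq Ms a; rewrite -/u ub ab eqxx.
have vb : v != b.
  apply/eqP => vb; have := mpos_gap Ms v (opp a).
  have ovb : opp v = b by rewrite vb (opp_b bdry_b).
  rewrite ovb posb cv; case/orP: alast => [/eqP ab|lt_a].
    by have := mccw_neq Ms v; rewrite cv ab vb eqxx.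
  have ab : a != b.
    apply: contraTneq lt_a => ->.
    by rewrite posb -leNgt (mpos_ge0 Ms).
  rewrite (hi_nb M ab) leNgt (mpos_gt0 Ms) ?oppb //=.
  by rewrite leNgt lt_a.
have XN h : mX M h != 0 by apply: (mX_neq0 V Ms).
have ubo : opp u != b by rewrite oppb.
have vbo : opp v != b by rewrite oppb.
pose T := ypow y (mZ M u) * mX M a * Shi b f M a.
pose z2 := (mX M u * mS M (opp u)) * (mX M v * mS M (opp v)).
have ET : mX M u * double_twist M v = z2 + T.
  have Sv := mS_ccw Ms u; rewrite -/v cv Shi_nb // in Sv.
  have Sa := mS_ccw Ms v; rewrite cv -/u in Sa.
  have mv := mZ_mm Ms v; rewrite cv -/u in mv.
  rewrite /double_twist /z2 /T Sv Sa -mv (ypowD V).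
  by apply: triangle_identity; rewrite !XN.
have valT : hv T (mZ M u + 0 + mZ M v).
  apply: (hv_mul V); last by rewrite -cv; apply: val_Shi.
  by apply: (hv_mul V); [apply: (hv_ypow V)|apply: mX_val Ms a].
have valz2 : hv z2 (0 + mZ M (c (c (opp u))) + (0 + mZ M (c (c (opp v))))).
  apply: (hv_mul V); (apply: (hv_mul V); [exact: mX_val Ms _|exact: val_S]).
set eT := (X in hv T X) in valT; set e2 := (X in hv z2 X) in valz2.
(* The decisive inequality: the corners of [T] follow the ends [opp u] and [opp v], and those giving
   the valuation of [z2] precede them. *)
have leT : vle eT e2.
  move=> i; have := ge_exp ubo i; have := ge_exp vbo i.
  by rewrite !oppK /eT /e2 !ffunE; lra.
suff : divA eT T.
  move/divA_primA/(_ valT); rewrite /T -mulrA; exact: primA_ypow_inv.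
have valz1 := hv_add V valz2 valT; rewrite -ET in valz1.
have primz1 : primA (mX M u * double_twist M v).
  by apply: primAM; [apply: primA_X Ms Rs|apply: double_twistP Ms Rs vb].
have divz1 : divA eT (mX M u * double_twist M v).
  by apply: primA_divA primz1 valz1 _ => i; rewrite vminE le_min lexx andbT; apply: leT.
have [ua|au] := ltP (mpos M (opp u)) (hi b M a).
  have IH w : w != b -> mpos M w < hi b M a -> primA (mX M w * mS M w).
    move=> wb lt_w; rewrite -(Shi_nb f M wb); apply: IHn.
    apply: leq_trans le_n; apply/proper_card/properP; split; last first.
      by exists w; rewrite !inE ?(hi_nb M wb) ?ltxx.
    by apply/subsetP => x; rewrite !inE (hi_nb M wb) => /lt_trans->.
  have -> : T = mX M u * double_twist M v - z2 by rewrite ET addrC addKr.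
  apply: divAB divz1 _; apply: primA_divA valz2 leT.
  by apply: primAM; [have := IH _ ubo ua|have := IH _ vbo lta]; rewrite (mX_opp Ms).
have ab : a != b.
  by apply: contraTneq au => ->; rewrite /hi eqxx -ltNge (mpos_lt1 Ms).
rewrite (hi_nb M ab) in au lta; rewrite (hi_nb M ub) in ltu; rewrite (hi_nb M vb) in ltv.
have lt_a : mpos M (opp a) < mpos M a by case/orP: alast => // /eqP; move/eqP: ab.
have le_ua : mpos M u <= mpos M a.
  have := mpos_gap Ms a a; rewrite -/u (hi_nb M ub) => /orP[|//]; lra.
have le_uv : mpos M u <= mpos M (opp v).
  have := mpos_gap Ms v u; rewrite cv (hi_nb M ab) => /orP[//|le_au].
  have /pinj ua : mpos M u = mpos M a by apply/eqP; rewrite eq_le le_ua.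
  by have := mccw_neq Ms a; rewrite -/u ua eqxx.
have lt_uv : mpos M u < mpos M (opp v).
  rewrite lt_neqAle le_uv andbT (inj_eq pinj); apply: contraTneq ltv => ->.
  by rewrite oppK ltxx.
(* The ends occur in the order [u], [opp v], [opp u], [v], so neither arc has its other end between
   [u] and [opp v]. *)
have [||M' [s' [Ms' Rs' E same]]] := fan Ms Rs lt_uv.
- by rewrite negb_and -ltNge (lt_le_trans lta au) orbT.
- by rewrite oppK negb_and -!ltNge -leNgt orbC ltW // (lt_trans lta) // (le_lt_trans au).
have [eXu eSu _ ePu] : same_at M M' u by apply: same; rewrite !inE eqxx ?orbT.
have [_ eSu' _ ePu'] : same_at M M' (opp u) by apply: same; rewrite !inE eqxx ?orbT.
have [_ eSv _ _] : same_at M M' (opp v) by apply: same; rewrite !inE eqxx ?orbT.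
have [eXv _ _ ePv] : same_at M M' v by apply: same; rewrite oppK !inE eqxx ?orbT.
have [_ _ em _] : same_at M M' u by apply: same; rewrite !inE eqxx ?orbT.
pose w := mccw M' (opp v).
have cw : mccw M' w = opp u by rewrite /w -E (mccw3 Ms').
have XN' h : mX M' h != 0 by apply: (mX_neq0 V Ms').
have lt_w : mpos M' (opp w) < mpos M (opp u).
  by have := mpos_ccw Ms' w; rewrite cw (hi_nb M' ubo) ePu'.
have wb : w != b.
  apply/eqP => wb; have := mpos_gap Ms' w u.
  rewrite cw wb (opp_b bdry_b) (hi_nb M' ubo) ePu' ePu (mpos_b Ms').
  by rewrite !leNgt (mpos_gt0 Ms ub) (lt_trans lt_uv (lt_le_trans lta au)).
have lt_w' : mpos M v < mpos M' w.
  by have := mpos_ccw Ms' (opp v); rewrite -/w oppK (hi_nb M' wb) ePv.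
have primw : primA (mX M' (opp w) * mS M' (opp w)).
  apply: first_end Ms' Rs' _ _; first by rewrite oppb.
  by rewrite oppK ltW // (lt_trans lt_w) // (lt_trans ltv).
have Ez2 : z2 = mX M v * double_twist M u
    + ypow y (mZ M' (opp u)) * (mX M' (opp w) * mS M' (opp w)).
  have Sv := mS_ccw Ms' (opp u).
  rewrite E -/w oppK Shi_nb // !(mX_opp Ms') eSu eSv eXu eXv in Sv.
  have Su := mS_ccw Ms' w.
  rewrite cw Shi_nb // E !(mX_opp Ms') eSu' eXu eXv in Su.
  have mu := mZ_mm Ms' (opp u); rewrite E -/w (mm_opp Ms') em in mu.
  rewrite /z2 /double_twist -mu (ypowD V) (mX_opp Ms').
  by apply: crossing_identity Sv Su; rewrite !XN XN'.
have primt : primA (mX M v * double_twist M u).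
  by apply: primAM; [apply: primA_X Ms Rs|apply: double_twistP Ms Rs ub].
have {}primw := primA_ypow (mZ M' (opp u)) primw.
have [et valt] := primA_hv primt; have [ew valw] := primA_hv primw.
(* The known valuation of [z2] is the minimum of those of its two positive terms, so [eT] bounds
   both without computing any exponent in [M']. *)
have := hv_add V valt valw; rewrite -Ez2 => /(hv_uniq V valz2) Ee2.
have divz2 : divA eT z2.
  have -> : z2 = mX M v * double_twist M u
    - (0 - ypow y (mZ M' (opp u)) * (mX M' (opp w) * mS M' (opp w))).
    by rewrite sub0r opprK Ez2.
  have le_min2 i : (eT i <= et i) && (eT i <= ew i).
    by have := leT i; rewrite Ee2 vminE le_min.
  apply: divAB; first by apply: primA_divA primt valt _ => i; case/andP: (le_min2 i).
  apply: divAB; first by exists 0; [rewrite mulr0|apply: A0].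
  by apply: primA_divA primw valw _ => i; case/andP: (le_min2 i).
have -> : T = mX M u * double_twist M v - z2 by rewrite ET addrC addKr.
exact: divAB.
Qed.

(** The corner of [c (c b)] is the one that closes the cycle; its exponent 0 is the valuation of
    [f], so the monomial given by [end_primA] is trivial. *)
Lemma cluster_algebra_end : mZ M (c (c b)) = 0 -> A f.
Proof.
move=> Z0; have := end_primA b; rewrite (mX_b Ms) mul1r /Shi eqxx => -[e [g [Ef g0 Ag]]].
have := val_Shi (c (c b)); rewrite (mccw3 Ms) /Shi eqxx Z0 => valf.
have := hv_mul V (hv_ypow V e) g0; rewrite -Ef addr0 => /(hv_uniq V valf) e0.
by rewrite Ef -e0 ypow0 mul1r.
Qed.

End Initial.

End Reachable.

(** * The initial triangulation *)

Section OneBoundary.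

Variable O : orbifold.

Local Notation I := (arc O).
Local Notation vec := {ffun I -> int}.
Local Notation turn := (@turn O).

Lemma ccw_inj : injective (@ccw O).
Proof. by move=> h h' E; rewrite -(ccw3 h) E ccw3. Qed.

Lemma turn_inj : injective turn.
Proof. exact: inj_comp ccw_inj (inv_inj (@oppK O)). Qed.

Variable b : O.
Hypotheses (bdry_b : bdry O = [set b]) (unp : unpunctured O).

Definition end_rank (h : O) : nat := findex turn b h.

Local Notation N := (order turn b).

Lemma connect_b h : fconnect turn b h.
Proof.
have [b' b'b hb'] := unp h; move: b'b hb'; rewrite bdry_b inE => /eqP->.
by rewrite fconnect_sym //; apply: turn_inj.
Qed.

Lemma iter_rank h : iter (end_rank h) turn b = h.
Proof. exact: iter_findex (connect_b h). Qed.

Lemma rank_lt h : (end_rank h < N)%N.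
Proof. exact: findex_max (connect_b h). Qed.

Lemma rank_iter n : (n < N)%N -> end_rank (iter n turn b) = n.
Proof. exact: findex_iter. Qed.

Lemma rank_b : end_rank b = 0%N.
Proof. exact: findex0. Qed.

Lemma rank_inj : injective end_rank.
Proof. by move=> h h' E; rewrite -[h]iter_rank E iter_rank. Qed.

Lemma rank_turn h :
  if turn h == b then N = (end_rank h).+1 else end_rank (turn h) = (end_rank h).+1.
Proof.
have E : turn h = iter (end_rank h).+1 turn b by rewrite iterS iter_rank.
have := rank_lt h; rewrite leq_eqVlt => /orP[/eqP EN|lt_N].
  by rewrite E EN (iter_order turn_inj) eqxx.
have Er : end_rank (turn h) = (end_rank h).+1 by rewrite E rank_iter.
by case: eqP Er => // ->; rewrite rank_b.
Qed.

(** Exponent of the corner that follows the end [h]: the corresponding good matching encloses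
    exactly the tiles of the later crossings. *)
Definition later_ends (h : O) : vec :=
  [ffun i : I => #|[set x in val i | (end_rank h < end_rank x)%N]|%:Z].

Lemma later_ends_turn h : turn h != b ->
  later_ends h = later_ends (turn h) + [ffun i : I => (turn h \in val i)%:Z].
Proof.
move=> hb; apply/ffunP => i; rewrite !ffunE -PoszD.
have := rank_turn h; rewrite (negPf hb) => Er.
rewrite (cardsD1 (turn h)) addnC !inE Er ltnSn andbT; congr (Posz (_ + _)).
apply: eq_card => z; rewrite !inE; case: eqVneq => [->|zh] /=.
  by rewrite Er ltnn andbF.
by rewrite leq_eqVlt -Er (inj_eq rank_inj) eq_sym (negPf zh).
Qed.

Lemma later_ends_prev h : h != b ->
  later_ends (opp (ccw (ccw h))) = later_ends h + [ffun i : I => (h \in val i)%:Z].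
Proof.
have E : turn (opp (ccw (ccw h))) = h by rewrite /Defs.turn oppK ccw3.
by move=> hb; rewrite later_ends_turn E.
Qed.

Lemma later_ends_last h : turn h = b -> later_ends h = 0.
Proof.
move=> hb; have := rank_turn h; rewrite hb eqxx => EN.
apply/ffunP => i; rewrite !ffunE; apply/eqP; rewrite eqz_nat cards_eq0.
apply/eqP/setP => x; rewrite !inE; apply/negbTE.
by have := rank_lt x; rewrite EN ltnS leqNgt => /negPf->; rewrite andbF.
Qed.

Variables (K : fieldType) (y x : I -> K) (hv : K -> vec -> Prop).
Hypotheses (V : valuation y hv) (val_x : forall i, hv (x i) 0).

Definition side_value (h : O) : K := oapp x 1 (insub (arc_of h)).

Lemma side_value_arc (i : I) h : h \in val i -> side_value h = x i.
Proof. by move=> /val_arc hi; rewrite /side_value /arc_of -hi valK. Qed.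

Lemma side_value_b : side_value b = 1.
Proof.
rewrite /side_value insubN //; apply/negP => bA.
have := arc_bdry (exist _ (arc_of b) bA : I) (h := b).
by rewrite bdry_b !inE eqxx => /(_ isT).
Qed.

Lemma side_value_opp h : side_value (opp h) = side_value h.
Proof. by rewrite /side_value /arc_of oppK setUC. Qed.

Definition corner (h : O) : K := ypow y (later_ends h) *
  side_value (ccw (turn h)) / (side_value h * side_value (turn h)).

Definition corner_sum (n : nat) : K := \sum_(j < n) corner (iter j turn b).

(** Dividing the ranks by [N] puts the last occurrence of [b] at 1, as [hi] requires. *)
Definition principal_marking : marking O K := Marking (@ccw O) side_value
  (fun h => corner_sum (end_rank h)) (fun h => later_ends (opp h))
  (fun h => later_ends (opp h) + later_ends (opp (ccw (ccw h))))
  (fun h => (end_rank h)%:R / N%:R).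

Definition principal_seed_of : seed I K := Seed x (fun r j => match r with
  | inl i => exchange_matrix i j | inr i => Posz (i == j) end).

Lemma val_side h : hv (side_value h) 0.
Proof.
have [hb|hb] := boolP (h \in bdry O).
  by move: hb; rewrite bdry_b inE => /eqP->; rewrite side_value_b; apply: (hv_one V).
by have [i hi] := arc_ex hb; rewrite (side_value_arc hi).
Qed.

Lemma corner_val h : hv (corner h) (later_ends h).
Proof.
have := hv_mul V (hv_mul V (hv_ypow V (later_ends h)) (val_side (ccw (turn h))))
  (hv_inv V (hv_mul V (val_side h) (val_side (turn h)))).
by rewrite !addr0 oppr0 addr0.
Qed.

(** The exponents decrease along the cycle, so the minimum is attained at the last corner. *)
Lemma corner_sum_val n : (n < N)%N ->
  hv (corner_sum n.+1) (later_ends (iter n turn b)).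
Proof.
rewrite /corner_sum; elim: n => [|n IHn] lt_n.
  by rewrite big_ord_recl big_ord0 addr0; apply: corner_val.
rewrite big_ord_recr /=; have := hv_add V (IHn (ltnW lt_n)) (corner_val (turn (iter n turn b))).
congr hv; apply/ffunP => i; rewrite vminE (later_ends_turn (h := iter n turn b)).
  by rewrite ffunE; apply: min_r; rewrite ler_wpDr // ffunE.
have := rank_turn (iter n turn b); case: eqP => // _.
by rewrite rank_iter ?(ltnW lt_n) // => E; rewrite E ltnn in lt_n.
Qed.

(** The factor 2 of a pending arc lets its single side count both as [g] and as [opp g]. *)
Lemma sum_arc (j : I) g (F : O -> int) : g \in val j ->
  (if #|val j| == 1%N then 2 else 1) * \sum_(h in val j) F h = F g + F (opp g).
Proof.
move=> gj; rewrite (val_arc gj) cards2; have [E|E] := eqVneq g (opp g).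
  by rewrite -E setUid big_set1 mulrDl mul1r.
by rewrite /= mul1r big_setU1 ?inE //= big_set1.
Qed.

Lemma exchange_matrixE (i j : I) g : g \in val j -> exchange_matrix i j =
  (ccw g \in val i)%:Z - (ccw (ccw g) \in val i)%:Z
  + (ccw (opp g) \in val i)%:Z - (ccw (ccw (opp g)) \in val i)%:Z.
Proof.
move=> gj; rewrite /exchange_matrix exchange_big (sum_arc _ gj).
have countE z : \sum_(h in val i) Posz (h == z) = (z \in val i)%:Z.
  have [zi|zi] := boolP (z \in val i).
    by rewrite (bigD1 z) //= eqxx big1 ?addr0 // => h /andP[_ /negPf->].
  by rewrite big1 // => h hi; case: eqP => // E; rewrite -E hi in zi.
have sumE z : \sum_(h in val i) (Posz (h == ccw z) - Posz (z == ccw h))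
    = (ccw z \in val i)%:Z - (ccw (ccw z) \in val i)%:Z.
  rewrite sumrB countE; congr (_ - _); rewrite -countE; apply: eq_bigr => h _.
  by rewrite -(inj_eq (inj_comp ccw_inj ccw_inj)) /= ccw3 eq_sym.
by rewrite !sumE addrA.
Qed.

Lemma Shi_turn h : Shi b (corner_sum N) principal_marking (turn h)
    = corner_sum (end_rank h).+1.
Proof. by rewrite /Shi; have := rank_turn h; case: eqP => _ /= ->. Qed.

Lemma principal_marked :
  marked y hv b (corner_sum N) principal_marking principal_seed_of.
Proof.
have opp_b := opp_b bdry_b.
have N0 : 0 < N%:R :> rat by rewrite ltr0n (leq_ltn_trans _ (rank_lt b)).
have hi_turn h : hi b principal_marking (ccw h) = (end_rank (opp h)).+1%:R / N%:R.
  have := rank_turn (opp h); rewrite /Defs.turn oppK /hi; case: eqP => _ /= ->//.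
  by rewrite divff // pnatr_eq0.
split=> /=.
- exact: ccw_neq.
- exact: ccw3.
- exact: side_value_b.
- by move=> i h; apply: side_value_arc.
- exact: val_side.
- by rewrite rank_b /corner_sum big_ord0.
- move=> h; rewrite -{1}[h]oppK -/(turn (opp h)) Shi_turn.
  rewrite /corner_sum big_ord_recr /= iter_rank; congr (_ + _).
  by rewrite /corner /Defs.turn oppK side_value_opp.
- by [].
(* For [h != b], both sums equal [later_ends h + later_ends (opp h)] plus the indicator of the arc
   of [h]. *)
- move=> h; rewrite oppK; have [->|hb] := eqVneq h b; first by rewrite opp_b.
  have hb' : opp h != b by rewrite (opp_eqb bdry_b).
  rewrite (later_ends_prev hb) (later_ends_prev hb') addrCA !addrA; congr (_ + _).
  by apply/ffunP => i; rewrite !ffunE -{2}[h]oppK; congr (Posz (nat_of_bool _)); apply/idP/idP => /opp_arc; rewrite ?oppK.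
- by rewrite rank_b mul0r.
- move=> h hb; rewrite divr_gt0 // ltr0n lt0n; apply: contraNneq hb => h0.
  by apply/eqP/rank_inj; rewrite h0 rank_b.
- by move=> h; rewrite ltr_pdivrMr // mul1r ltr_nat rank_lt.
- move=> h g /(mulIf (invr_neq0 (lt0r_neq0 N0)))/eqP.
  by rewrite eqr_nat => /eqP/rank_inj.
- move=> h; rewrite hi_turn ltr_pM2r ?invr_gt0 // ltr_nat; exact: ltnSn.
- move=> h g; rewrite hi_turn !ler_pM2r ?invr_gt0 // !ler_nat.
  exact: leqVgt.
- exact: exchange_matrixE.
(* Principal coefficients: passing an end lowers the exponent by one at its own arc. *)
- move=> i j g gj; rewrite oppK (later_ends_prev (h := g)).
    rewrite addrC addKr ffunE; congr (Posz (nat_of_bool _)).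
    by apply/eqP/idP => [->//|gi]; apply: arc_uniq gi gj.
  by apply: contraTneq gj => ->; rewrite arc_bdry // bdry_b inE.
Qed.

Lemma corner_sum_cluster_algebra : cluster_algebra y principal_seed_of (corner_sum N).
Proof.
apply: (cluster_algebra_end V bdry_b principal_marked) => [h|h hb|] /=.
- rewrite -[h in ccw h]oppK Shi_turn -{2}[opp h]iter_rank.
  exact: corner_sum_val (rank_lt _).
- by move=> i; rewrite oppK later_ends_prev // !ffunE ler_wpDr.
- by apply: later_ends_last; rewrite /Defs.turn oppK ccw3.
Qed.

End OneBoundary.

(** * The band graph of the boundary loop *)

Definition incident (S : orbifold) (f : point -> point) (v : point) (e : edge S) : bool :=
  (f (edge_src e) == v) || (f (edge_tgt e) == v).

Definition covered (S : orbifold) (f : point -> point) (P : {fset edge S}) v : Prop :=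
  exists e, [/\ e \in P, incident f v e
    & forall e', e' \in P -> incident f v e' -> e' = e].

Lemma covered_uniq (S : orbifold) f (P : {fset edge S}) v e e' : covered f P v ->
  e \in P -> incident f v e -> e' \in P -> incident f v e' -> e = e'.
Proof. by move=> [e0 [_ _ U]] eP ie e'P ie'; rewrite (U e eP ie) (U e' e'P ie'). Qed.

Lemma perfect_matchingP (S : orbifold) f (E P : {fset edge S}) :
  reflect ((P `<=` E)%fset /\ forall e, e \in E ->
            covered f P (f (edge_src e)) /\ covered f P (f (edge_tgt e)))
          (perfect_matching f E P).
Proof.
have cardP v : reflect (covered f P v) (#|` [fset e in P | incident f v e]%fset| == 1%N).
  apply: (iffP (cardfs1P _)) => [[e /fsetP Ee]|[e [eP ie U]]].
    have := Ee e; rewrite !inE eqxx => /andP[eP ie]; exists e; split=> // e' e'P ie'.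
    by have := Ee e'; rewrite !inE e'P ie' => /esym/eqP.
  exists e; apply/fsetP => e'; rewrite !inE; apply/andP/eqP => [[e'P ie']|->//].
  exact: U.
rewrite /perfect_matching all_cat; apply: (iffP andP) => -[PE].
  move=> /andP[/allP src /allP tgt]; split=> // e eE.
  by split; apply/cardP; [apply: src|apply: tgt]; apply/mapP; exists e.
move=> cov; split=> //; apply/andP; split; apply/allP => v /mapP[e eE ->];
  by apply/cardP; case: (cov e eE).
Qed.

(** * Snake graph of a curve turning around one vertex *)

Section FanBand.

Variables (S : orbifold) (h : S) (w : seq S).

Local Notation n := (size w).+1.
Local Notation H := (nth h (h :: w)).

Hypothesis fan_w : forall i, (i < size w)%N -> H i.+1 = ccw (opp (H i)).
Hypothesis fan_h : h = ccw (ccw (opp (last h w))).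
Hypothesis w_gt0 : (0 < size w)%N.

(* The tiles form a staircase, along the path with vertices [spine 0], ...,
   [spine n.+1].  Tile [i] has corners [spine i], [spine i.+1], [spine i.+2] and
   [outer i]; the latter is a corner of no other tile. *)
Definition spine (i : nat) : point := (i./2, uphalf i).

Definition outer (i : nat) : point :=
  if odd i then (i./2, (uphalf i).+1) else ((i./2).+1, uphalf i).

(** For [0 < j < n] this is the edge shared by the tiles [j.-1] and [j], labelled from the latter;
    for [j = n] only the tile [n.-1] can provide the label. *)
Definition spine_edge (j : nat) : edge S :=
  (spine j, odd j, if (j < n)%N then ccw (H j) else ccw (ccw (opp (H j.-1)))).

Definition low_edge (i : nat) : edge S := (spine i, ~~ odd i, ccw (ccw (H i))).

Definition high_edge (i : nat) : edge S := (outer i, odd i, ccw (opp (H i))).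

Lemma spine_sum i : ((spine i).1 + (spine i).2 = i)%N.
Proof. by rewrite /= addnC uphalf_half -addnA addnn odd_double_half. Qed.

Lemma spine_inj : injective spine.
Proof. by move=> i j E; rewrite -(spine_sum i) E spine_sum. Qed.

Lemma outer_sum i : ((outer i).1 + (outer i).2 = i.+1)%N.
Proof.
by rewrite /outer; case: (odd i) => /=; rewrite ?addnS ?addSn; congr _.+1; apply: (spine_sum i).
Qed.

Lemma outer_inj : injective outer.
Proof. by move=> i j E; apply/succn_inj; rewrite -outer_sum E outer_sum. Qed.

Lemma outer_spine i j : outer i != spine j.
Proof.
apply/eqP => E; have := outer_sum i; rewrite E spine_sum => Ej.
move: E; rewrite /outer /spine Ej /= uphalf_half.
by case: (odd i) => -[]; lia.
Qed.

Lemma spine_edge_src j : edge_src (spine_edge j) = spine j. Proof. by []. Qed.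
Lemma low_edge_src j : edge_src (low_edge j) = spine j. Proof. by []. Qed.
Lemma high_edge_src j : edge_src (high_edge j) = outer j. Proof. by []. Qed.

Lemma spine_edge_tgt j : edge_tgt (spine_edge j) = spine j.+1.
Proof.
by rewrite /edge_tgt /spine_edge /spine /= !uphalf_half; case: (odd j).
Qed.

Lemma low_edge_tgt i : edge_tgt (low_edge i) = outer i.
Proof. by rewrite /edge_tgt /low_edge /outer /=; case: (odd i). Qed.

Lemma high_edge_tgt i : edge_tgt (high_edge i) = spine i.+2.
Proof.
by rewrite /edge_tgt /high_edge /outer /spine /=; case: (odd i).
Qed.

Lemma eq_spine_edge j k : (spine_edge j == spine_edge k) = (j == k).
Proof.
apply/eqP/eqP => [|->//] /(congr1 (@edge_src S)).
by rewrite !spine_edge_src => /spine_inj.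
Qed.

Lemma eq_low_edge j k : (low_edge j == low_edge k) = (j == k).
Proof.
by apply/eqP/eqP => [|->//] /(congr1 (@edge_src S)); rewrite !low_edge_src => /spine_inj.
Qed.

Lemma eq_high_edge j k : (high_edge j == high_edge k) = (j == k).
Proof.
by apply/eqP/eqP => [|->//] /(congr1 (@edge_src S)); rewrite !high_edge_src => /outer_inj.
Qed.

Lemma eq_spine_low j k : (spine_edge j == low_edge k) = false.
Proof.
apply/eqP => E; have /spine_inj jk := congr1 (@edge_src S) E.
have := congr1 (fun e : edge S => e.1.2) E; rewrite /= jk.
by case: (odd k).
Qed.

Lemma eq_spine_high j k : (spine_edge j == high_edge k) = false.
Proof.
apply/eqP => /(congr1 (@edge_src S)); rewrite spine_edge_src high_edge_src => /esym/eqP.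
by rewrite (negPf (outer_spine k j)).
Qed.

Lemma eq_low_high j k : (low_edge j == high_edge k) = false.
Proof.
apply/eqP => /(congr1 (@edge_src S)); rewrite low_edge_src high_edge_src => /esym/eqP.
by rewrite (negPf (outer_spine k j)).
Qed.

Lemma eq_low_spine j k : (low_edge j == spine_edge k) = false.
Proof. by rewrite eq_sym eq_spine_low. Qed.

Lemma eq_high_spine j k : (high_edge j == spine_edge k) = false.
Proof. by rewrite eq_sym eq_spine_high. Qed.

Lemma eq_high_low j k : (high_edge j == low_edge k) = false.
Proof. by rewrite eq_sym eq_low_high. Qed.

Definition eq_edgeE := (eq_spine_edge, eq_low_edge, eq_high_edge, eq_spine_low,
  eq_spine_high, eq_low_high, eq_low_spine, eq_high_spine, eq_high_low).

Definition fan_tile (i : nat) : tile S := mk_tile (~~ odd i) (spine i) (H i).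

(** The curve always turns the same way while the relative orientation alternates, so the gluing
    edge is alternately north and east. *)
Lemma snake_tilesE : snake_tiles h w = [seq fan_tile i | i <- iota 0 n].
Proof.
rewrite /snake_tiles; have -> : (0, 0)%N = spine 0 by [].
suff tilesE k v g : (forall i, (i <= size v)%N -> H (k + i) = nth h (g :: v) i) ->
    (k + size v < n)%N ->
    tiles_from (~~ odd k) (spine k) g v = [seq fan_tile i | i <- iota k (size v).+1].
  by rewrite (tilesE 0%N) //.
elim: v k g => [|g' v IHv] k g Hv lt_n /=.
  by congr [:: _]; rewrite /fan_tile -(addn0 k) (Hv 0%N).
have Hk : H k = g by rewrite -(addn0 k) (Hv 0%N).
have Hk1 : H k.+1 = g' by rewrite -(addn1 k) (Hv 1%N).
have Eg : g' = ccw (opp g).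
  by rewrite -Hk1 -Hk fan_w //; move: lt_n; rewrite /=; lia.
congr (_ :: _); first by rewrite /fan_tile Hk.
have -> : (if g' == edge_label (tileE (mk_tile (~~ odd k) (spine k) g))
   then ((spine k).1, (spine k).2.+1) else ((spine k).1.+1, (spine k).2)) = spine k.+1.
  rewrite /edge_label /spine /= uphalf_half; case: (odd k) => /=.
    by rewrite Eg eq_sym (negPf (ccw_neq _)) !add1n.
  by rewrite Eg eqxx !add0n.
have -> : ~~ ~~ odd k = ~~ odd k.+1 by [].
rewrite IHv // => [i le_i|]; last by move: lt_n => /=; lia.
by rewrite addSnnS Hv.
Qed.

Lemma spine_edgeS i : (i < n)%N -> spine_edge i.+1 = (spine i.+1, ~~ odd i, ccw (ccw (opp (H i)))).
Proof.
move=> lt_n; rewrite /spine_edge /=; congr (_, _, _).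
case: ltnP => // lt_i; by rewrite -[nth h w i]/(H i.+1) fan_w.
Qed.

Lemma fan_tileE i : (i < n)%N -> tile_edges (fan_tile i) =
  [fset spine_edge i; low_edge i; high_edge i; spine_edge i.+1]%fset.
Proof.
move=> lt_n; rewrite spine_edgeS //.
rewrite /tile_edges /fan_tile /spine_edge /low_edge /high_edge lt_n /=.
apply/fsetP => e; rewrite !(in_fsetU, in_fset1) /outer /spine /= uphalf_half.
by case: (odd i) => /=; rewrite ?add0n ?add1n; do 4!case: (e == _).
Qed.

Local Notation E := (snake_edges h w).

Variant fan_edge : edge S -> Prop :=
| FanSpine j of (j <= n)%N : fan_edge (spine_edge j)
| FanLow i of (i < n)%N : fan_edge (low_edge i)
| FanHigh i of (i < n)%N : fan_edge (high_edge i).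

Lemma snake_edgesP e : e \in E <-> exists2 i, (i < n)%N & e \in tile_edges (fan_tile i).
Proof.
rewrite /snake_edges snake_tilesE big_map; split.
  by move=> /bigfcupP[i]; rewrite andbT mem_iota add0n => /andP[_ lt_i] eT; exists i.
by move=> [i lt_i eT]; apply/bigfcupP; exists i => //; rewrite andbT mem_iota add0n.
Qed.

Lemma in_snake e : e \in E -> fan_edge e.
Proof.
move/snake_edgesP => [i lt_i]; rewrite fan_tileE // !inE.
by case/orP=> [/orP[/orP[]|]|] /eqP->; constructor; rewrite // ltnW.
Qed.

Lemma fan_edge_in e : fan_edge e -> e \in E.
Proof.
case=> [j le_j|i lt_i|i lt_i]; apply/snake_edgesP.
- case: j le_j => [|j] lt_j; first by exists 0%N; rewrite ?fan_tileE // !inE eqxx.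
  by exists j; rewrite ?fan_tileE // !inE eqxx !orbT.
- by exists i; rewrite ?fan_tileE // !inE eqxx !orbT.
- by exists i; rewrite ?fan_tileE // !inE eqxx !orbT.
Qed.

Lemma low_snake j : (low_edge j \in E) = (j < n)%N.
Proof.
apply/idP/idP => [sE|le_j]; last by apply: fan_edge_in; constructor.
by case Ee : _ / (in_snake sE) => [k _|k lt_k|k _]; move/eqP: Ee; rewrite eq_edgeE // => /eqP->.
Qed.

(** The spine edge [j] separates the tiles matched along low edges from those matched along high
    edges; it stands for the corner [j] of the fan. *)
Definition fan_matching (j : nat) : {fset edge S} :=
  [fset e in spine_edge j :: [seq low_edge i | i <- iota 0 j]
     ++ [seq high_edge i | i <- iota j (n - j)]]%fset.

Lemma fan_matchingE j e : (e \in fan_matching j) = [|| e == spine_edge j,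
  e \in [seq low_edge i | i <- iota 0 j] | e \in [seq high_edge i | i <- iota j (n - j)]].
Proof. by rewrite /fan_matching !inE. Qed.

Lemma spine_fan_matching j k : (spine_edge k \in fan_matching j) = (k == j).
Proof.
rewrite fan_matchingE eq_edgeE; case: eqVneq => //= _.
apply/negbTE; rewrite negb_or; apply/andP; split; apply/mapP => -[i _ /eqP];
  by rewrite eq_edgeE.
Qed.

Lemma low_fan_matching j k : (low_edge k \in fan_matching j) = (k < j)%N.
Proof.
rewrite fan_matchingE eq_edgeE /=; apply/orP/idP => [[]/mapP[i]|lt_k].
- by rewrite mem_iota add0n => /andP[_ lt_i] /eqP; rewrite eq_edgeE => /eqP->.
- by move=> _ /eqP; rewrite eq_edgeE.
- by left; apply/map_f; rewrite mem_iota.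
Qed.

Lemma high_fan_matching j k : (j <= n)%N ->
  (high_edge k \in fan_matching j) = (j <= k < n)%N.
Proof.
move=> le_j; rewrite fan_matchingE eq_edgeE /=; apply/orP/idP => [[]/mapP[i]|lt_k].
- by move=> _ /eqP; rewrite eq_edgeE.
- by rewrite mem_iota subnKC // => lt_i /eqP; rewrite eq_edgeE => /eqP->.
- by right; apply/map_f; rewrite mem_iota subnKC.
Qed.

Definition in_fan_matching := (spine_fan_matching, low_fan_matching, high_fan_matching).

Lemma fan_matching_sub j : (j <= n)%N -> (fan_matching j `<=` E)%fset.
Proof.
move=> le_j; apply/fsubsetP => e; rewrite fan_matchingE => /orP[/eqP->|/orP[]/mapP[i]].
- by apply: fan_edge_in; constructor.
- rewrite mem_iota add0n => /andP[_ lt_i] ->; apply: fan_edge_in; constructor.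
  exact: leq_trans lt_i le_j.
- rewrite mem_iota subnKC // => /andP[_ lt_i] ->; apply: fan_edge_in; by constructor.
Qed.

Lemma incident_spine j e : fan_edge e -> incident id (spine j) e =
  (e \in [:: spine_edge j; low_edge j]) || (if j is j'.+1 then e == spine_edge j' else false)
  || (if j is j'.+2 then e == high_edge j' else false).
Proof.
rewrite /incident; case=> k _ /=;
  rewrite ?(spine_edge_src, low_edge_src, high_edge_src,
            spine_edge_tgt, low_edge_tgt, high_edge_tgt) ?inE ?eq_edgeE
          ?(negPf (outer_spine _ _)) ?(inj_eq spine_inj) ?orbF.
- case: j => [|[|j]]; rewrite ?eq_edgeE ?orbF //.
- case: j => [|[|j]]; rewrite ?eq_edgeE ?orbF //.
- case: j => [|[|j]]; rewrite ?eq_edgeE ?orbF //.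
Qed.

Lemma incident_outer j e : fan_edge e ->
  incident id (outer j) e = (e \in [:: low_edge j; high_edge j]).
Proof.
rewrite /incident; case=> k _ /=;
  rewrite ?(spine_edge_src, low_edge_src, high_edge_src,
            spine_edge_tgt, low_edge_tgt, high_edge_tgt) ?inE ?eq_edgeE
          ![spine _ == outer _]eq_sym ?(negPf (outer_spine _ _)) ?(inj_eq outer_inj) ?orbF //.
Qed.

Lemma fan_vertex (e : edge S) (C : point -> Prop) : fan_edge e ->
  (forall j, (j <= n.+1)%N -> C (spine j)) -> (forall i, (i < n)%N -> C (outer i)) ->
  C (edge_src e) /\ C (edge_tgt e).
Proof.
move=> fe Cs Co; case: fe => k lt_k.
- rewrite spine_edge_src spine_edge_tgt; split; apply: Cs => //; exact: leqW.
- rewrite low_edge_src low_edge_tgt; split; [apply: Cs|exact: Co].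
  by rewrite ltnW // ltnW.
- by rewrite high_edge_src high_edge_tgt; split; [apply: Co|apply: Cs].
Qed.

Lemma fan_matching_covers_spine j k : (j <= n)%N -> (k <= n.+1)%N ->
  covered id (fan_matching j) (spine k).
Proof.
move=> le_j le_k; have fanE e : e \in fan_matching j -> fan_edge e.
  by move/(fsubsetP (fan_matching_sub le_j))/in_snake.
pose e := if (k < j)%N then low_edge k else
  if (k <= j.+1)%N then spine_edge j else high_edge k.-2.
have fe : fan_edge e.
  rewrite /e; case: ltnP => [lt_k|ge_k]; first by constructor; apply: leq_trans le_j.
  case: leqP => [_|lt_k]; first by constructor.
  by constructor; case: k lt_k le_k {ge_k e} => [|[|k]].
exists e; split.
- rewrite /e; case: ltnP => [lt_k|ge_k]; first by rewrite low_fan_matching.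
  case: leqP => [_|lt_k]; first by rewrite spine_fan_matching.
  rewrite high_fan_matching //; case: k lt_k le_k {fe ge_k e} => [|[|k]] //=.
  by rewrite !ltnS => -> ->.
- rewrite incident_spine // /e; case: ltnP => [lt_k|ge_k].
    by rewrite !inE eqxx orbT.
  case: leqP => [le_kj|lt_k].
    case: (eqVneq k j) => [->|kj]; first by rewrite !inE eqxx.
    have -> : k = j.+1 by apply/eqP; rewrite eqn_leq le_kj ltn_neqAle eq_sym kj ge_k.
    by rewrite eqxx !orbT.
  by case: k lt_k {fe le_k ge_k e} => [|[|k]] //= _; rewrite eqxx !orbT.
move=> e' e'P; rewrite (incident_spine k (fanE _ e'P)) /e.
case/orP=> [/orP[]|].
- rewrite !in_cons orbF => /orP[] /eqP E'; move: e'P; rewrite E' in_fan_matching.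
    by move/eqP->; rewrite ltnn leqnSn.
  by move->.
- case: k le_k {fe e} => [|k] // le_k /eqP E'; move: e'P; rewrite E' in_fan_matching.
  by move=> /eqP->; rewrite ltnNge leqnSn leqnn.
- case: k le_k {fe e} => [|[|k]] // le_k /eqP E'; move: e'P; rewrite E' high_fan_matching //.
  by move=> /andP[le_jk _]; rewrite ltnNge (leqW (leqW le_jk)) /= leqNgt !ltnS le_jk.
Qed.

Lemma fan_matching_covers_outer j k : (j <= n)%N -> (k < n)%N ->
  covered id (fan_matching j) (outer k).
Proof.
move=> le_j lt_k; have fanE e : e \in fan_matching j -> fan_edge e.
  by move/(fsubsetP (fan_matching_sub le_j))/in_snake.
exists (if (k < j)%N then low_edge k else high_edge k); split.
- by case: ltnP => [|ge_k]; rewrite ?low_fan_matching // high_fan_matching // ge_k.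
- by case: ifP => _; rewrite incident_outer ?in_cons ?eqxx ?orbT //; constructor.
move=> e' e'P; rewrite (incident_outer k (fanE _ e'P)) !in_cons orbF.
case/orP=> /eqP E'; move: e'P; rewrite E' ?low_fan_matching ?high_fan_matching //.
  by move->.
by move=> /andP[le_jk _]; rewrite ltnNge le_jk.
Qed.

Lemma fan_matchingP j : (j <= n)%N -> snake_matching h w (fan_matching j).
Proof.
move=> le_j; apply/perfect_matchingP; split; first exact: fan_matching_sub.
move=> e /in_snake fe; apply: (fan_vertex fe) => k le_k.
  exact: fan_matching_covers_spine.
exact: fan_matching_covers_outer.
Qed.

(** The vertex [outer i] only meets a low and a high edge, so one of them is chosen. With [j] the
    first index where the low edge is absent ([n] if there is none), [spine j] can only be covered
    by [spine_edge j], and this forces high edges from there on. *)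
Lemma snake_matchingP P : snake_matching h w P -> exists2 j, (j <= n)%N & P = fan_matching j.
Proof.
move=> /perfect_matchingP[/fsubsetP PE cov].
have fP e : e \in P -> fan_edge e by move/PE/in_snake.
have cov_spine k : (k <= n.+1)%N -> covered id P (spine k).
  rewrite leq_eqVlt => /orP[/eqP->|lt_k].
    have /fan_edge_in/cov[_] := FanSpine (leqnn n); by rewrite spine_edge_tgt.
  have /fan_edge_in/cov[] := @FanSpine k lt_k; by rewrite spine_edge_src.
have cov_outer k : (k < n)%N -> covered id P (outer k).
  move=> lt_k; have /fan_edge_in/cov[_] := FanLow lt_k; by rewrite low_edge_tgt.
have spine_uniq k e e' : (k <= n.+1)%N -> fan_edge e -> fan_edge e' ->
    e \in P -> e' \in P -> incident id (spine k) e -> incident id (spine k) e' -> e = e'.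
  by move=> le_k _ _ eP e'P ie ie'; apply: covered_uniq (cov_spine k le_k) eP ie e'P ie'.
have high_low i : (i < n)%N -> (high_edge i \in P) = (low_edge i \notin P).
  move=> lt_i; have fh := FanHigh lt_i; have fl := FanLow lt_i.
  apply/idP/idP => [hP|lP].
    apply/negP => lP; have := covered_uniq (cov_outer i lt_i) hP _ lP.
    by rewrite !incident_outer // !inE !eqxx orbT => /(_ isT isT) /eqP; rewrite eq_edgeE.
  have [e [eP ie _]] := cov_outer i lt_i; move: ie.
  by rewrite (incident_outer i (fP e eP)) !inE => /orP[] /eqP E'; move: eP lP; rewrite E' // => ->.
have inc1 k : incident id (spine k) (spine_edge k) by rewrite /incident eqxx.
have inc2 k : incident id (spine k.+1) (spine_edge k).
  by rewrite /incident spine_edge_tgt eqxx orbT.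
have inc3 k : incident id (spine k) (low_edge k) by rewrite /incident eqxx.
have inc4 k : incident id (spine k.+2) (high_edge k).
  by rewrite /incident high_edge_tgt eqxx orbT.
have clash k e e' : (k <= n.+1)%N -> e \in P -> e' \in P ->
    incident id (spine k) e -> incident id (spine k) e' -> e = e'.
  by move=> le_k eP e'P ie ie'; apply: covered_uniq (cov_spine k le_k) eP ie e'P ie'.
have exj : exists j, (n <= j)%N || (low_edge j \notin P) by exists n; rewrite leqnn.
case: (ex_minnP exj) => j jP jmin.
have le_j : (j <= n)%N by apply: jmin; rewrite leqnn.
have lowP i : (i < j)%N -> low_edge i \in P.
  by move=> lt_i; apply: contraTT lt_i => lP; rewrite -leqNgt jmin // lP orbT.
have spine_low k : (k < j)%N -> spine_edge k \notin P.
  move=> lt_k; apply/negP => sP.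
  have /eqP := clash k _ _ (ltnW (leq_trans lt_k (leqW le_j))) sP (lowP k lt_k) (inc1 k) (inc3 k).
  by rewrite eq_edgeE.
have high_low' i e : (i < j)%N -> high_edge i \in P -> e.
  move=> lt_i hP; have lt_n := leq_trans lt_i le_j.
  by move: (high_low i lt_n); rewrite hP (lowP i lt_i).
have ltE i : low_edge i \in P -> (i < n)%N.
  by move/PE; rewrite low_snake.
have spinejP : spine_edge j \in P.
  have [e [eP ie _]] := cov_spine j (leqW le_j).
  move: ie; rewrite (incident_spine j (fP e eP)); case/orP=> [/orP[]|].
  - rewrite !in_cons orbF => /orP[] /eqP E'; move: eP; rewrite E' // => lP.
    by move: jP; rewrite lP orbF leqNgt ltE.
  - case: (j) (spine_low) => // j' slow /eqP E'.
    by move: eP; rewrite E' (negPf (slow j' (ltnSn j'))).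
  - case: (j) (high_low') => [|[|j']] // hl /eqP E'; move: eP; rewrite E' => hP.
    by apply: hl hP; apply: leqnSn.
have high_geq i : (j <= i < n)%N -> high_edge i \in P.
  elim/ltn_ind: i => i IHi /andP[le_ji lt_i]; rewrite high_low //; apply/negP => lP.
  have le_i : (i <= n.+1)%N by rewrite ltnW // ltnW.
  move: le_ji; rewrite leq_eqVlt => /orP[/eqP ji|].
    by move: jP; rewrite ji lP orbF leqNgt lt_i.
  rewrite leq_eqVlt => /orP[/eqP ji|lt_ji].
    have ie : incident id (spine i) (spine_edge j) by rewrite -ji.
    by have /eqP := clash i _ _ le_i spinejP lP ie (inc3 i); rewrite eq_edgeE.
  case: i lt_ji lt_i lP le_i IHi => [|[|i]] // lt_ji lt_i lP le_i IHi.
  have hP : high_edge i \in P by apply: IHi; rewrite ?leqnSn // -ltnS -ltnS lt_ji ltnW // ltnW.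
  by have /eqP := clash i.+2 _ _ le_i hP lP (inc4 i) (inc3 _); rewrite eq_edgeE.
exists j => //; apply/fsetP => e; apply/idP/idP => [eP|].
  have fe := fP e eP; case: fe eP => k lt_k eP; rewrite in_fan_matching //.
  - have [lt_kj|lt_jk|//] := ltngtP k j; first by rewrite (negPf (spine_low k lt_kj)) in eP.
    have le_k : (k <= n.+1)%N by apply: leqW.
    move: lt_jk; rewrite leq_eqVlt => /orP[/eqP jk|lt_jk].
      have ie : incident id (spine k) (spine_edge j) by rewrite -jk.
      have /eqP := clash k _ _ le_k spinejP eP ie (inc1 k).
      by rewrite eq_edgeE => /eqP E'; move: jk; rewrite E' => /esym/n_Sn.
    case: k lt_jk lt_k eP le_k => [|[|k]] // lt_jk lt_k eP le_k.
    have hP : high_edge k \in P by apply: high_geq; rewrite -ltnS -ltnS lt_jk -ltnS.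
    by have /eqP := clash k.+2 _ _ le_k hP eP (inc4 k) (inc1 _); rewrite eq_edgeE.
  - rewrite ltnNge; apply/negP => le_jk.
    have := high_low k lt_k; rewrite eP high_geq // le_jk lt_k.
    by [].
  - rewrite lt_k andbT leqNgt; apply/negP => lt_kj; exact: (high_low' k False lt_kj eP).
rewrite fan_matchingE => /or3P[/eqP->//||] /mapP[i]; rewrite mem_iota.
  by rewrite add0n => /andP[_ lt_i] ->; apply: lowP.
by rewrite subnKC // => lt_i ->; apply: high_geq.
Qed.

(** * Cutting and gluing: good matchings and their weights *)

Lemma first_tileE : first_tile h w = fan_tile 0.
Proof. by rewrite /first_tile snake_tilesE. Qed.

Lemma last_tileE : last_tile h w = fan_tile (size w).
Proof.
rewrite /last_tile snake_tilesE -[X in iota 0 X]addn1 iotaD map_cat last_cat.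
by rewrite add0n.
Qed.

Lemma last_nthE : last h w = H (size w).
Proof. exact: last_nth. Qed.

Lemma cut_firstE : cut_first h w = low_edge 0.
Proof.
rewrite /cut_first first_tileE /edge_label /=.
have -> : opp (last h w) = ccw h by rewrite [in RHS]fan_h ccw3.
by rewrite (negPf (ccw_neq _)).
Qed.

Lemma cut_lastE : cut_last h w = high_edge (size w).
Proof.
have E := fan_h; rewrite last_nthE in E.
have ne : (ccw (opp (H (size w))) == h) = false.
  apply: contraNF (ccw_neq (ccw (opp (H (size w))))) => /eqP Eh.
  by rewrite -E Eh.
rewrite /cut_last last_tileE /high_edge /outer /edge_label.
by case Eo: (odd (size w)); rewrite /= Eo /= ?ne // -E eqxx.
Qed.

Lemma glueE v : glue h w v = if v == outer (size w) then spine 0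
  else if v == spine n.+1 then outer 0 else v.
Proof. by rewrite /glue cut_firstE cut_lastE high_edge_tgt low_edge_tgt. Qed.

Lemma band_edgesE : band_edges h w = (E `\ high_edge (size w))%fset.
Proof. by rewrite /band_edges cut_lastE. Qed.

(** Removing the cut edge [e] uncovers its endpoints [a] and [b], but these are identified with [a']
    and [b'], which [P] still covers. It serves for both copies of the cut edge. *)
Lemma cut_edge_matching P (e : edge S) a b a' b' :
  snake_matching h w P -> e \in P -> edge_src e = a -> edge_tgt e = b ->
  high_edge (size w) \notin (P `\ e)%fset ->
  a' \notin [:: a; b] -> b' \notin [:: a; b] -> covered id P a' -> covered id P b' ->
  (forall z, (glue h w z == spine 0) = (z \in [:: a; a'])) ->
  (forall z, (glue h w z == outer 0) = (z \in [:: b; b'])) ->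
  (forall z, z \notin [:: a; a'; b; b'] -> glue h w z = z) ->
  band_matching h w (P `\ e)%fset.
Proof.
move=> /perfect_matchingP[PE cov] eP sa tb hP a'n b'n cova covb ga gb gz.
apply/perfect_matchingP; split.
  rewrite band_edgesE; apply/fsubsetP => e' e'P; rewrite !inE.
  apply/andP; split; first by apply: contraNneq hP => <-.
  by move: e'P; rewrite !inE => /andP[_ /(fsubsetP PE)].
have ie z : z \in [:: a; b] -> incident id z e.
  by rewrite !inE /incident sa tb => /orP[] /eqP->; rewrite eqxx ?orbT.
have incz e' z : incident id z e' -> e' \in P -> z \in [:: a; b] -> e' = e.
  move=> ie' e'P zab; have [e1 [_ _ U]] : covered id P z.
    have [ca cb] := cov _ (fsubsetP PE _ eP); move: zab ca cb; rewrite sa tb !inE.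
    by case/orP=> /eqP->.
  by rewrite (U e') // (U e) //; apply: ie.
suff main x : covered id P x -> covered (glue h w) (P `\ e)%fset (glue h w x).
  move=> e' ; rewrite band_edgesE !inE => /andP[_ /cov[c1 c2]].
  by split; apply: main.
move=> covx.
(* Each fibre of the gluing has one representative [z0] outside [[:: a; b]], covered by an edge
   other than [e]. *)
suff rep z0 : covered id P z0 -> z0 \notin [:: a; b] -> glue h w z0 = glue h w x ->
    (forall z, glue h w z = glue h w x -> z = z0 \/ z \in [:: a; b]) ->
    covered (glue h w) (P `\ e)%fset (glue h w x).
  have [xa|xa] := boolP (glue h w x == spine 0).
    apply: (rep a') => //.
      by rewrite (eqP xa); apply/eqP; rewrite ga !inE eqxx orbT.
    move=> z; rewrite (eqP xa) => /eqP; rewrite ga !inE => /orP[] Ez.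
      by right; rewrite Ez.
    by left; apply/eqP.
  have [xb|xb] := boolP (glue h w x == outer 0).
    apply: (rep b') => //.
      by rewrite (eqP xb); apply/eqP; rewrite gb !inE eqxx orbT.
    move=> z; rewrite (eqP xb) => /eqP; rewrite gb !inE => /orP[] Ez.
      by right; rewrite Ez orbT.
    by left; apply/eqP.
  have xn : x \notin [:: a; a'; b; b'].
    move: xa xb; rewrite ga gb !in_cons !in_nil !orbF !negb_or.
    by move=> /andP[h1 h2] /andP[h3 h4]; rewrite h1 h2 h3 h4.
  apply: (rep x) => //.
    by move: xn; rewrite !inE !negb_or => /and4P[-> _ -> _].
  move=> z Ez; left; rewrite -(gz x xn) -Ez gz //.
  move: xa xb; rewrite -Ez ga gb !in_cons !in_nil !orbF !negb_or.
  by move=> /andP[h1 h2] /andP[h3 h4]; rewrite h1 h2 h3 h4.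
move=> [e0 [e0P ie0 U]] z0n gz0 fib; exists e0; split.
- rewrite !inE e0P andbT; apply: contraNneq z0n => E0; move: ie0.
  by rewrite E0 /incident sa tb !inE ![_ == z0]eq_sym.
- by rewrite /incident -gz0; case/orP: ie0 => /eqP->; rewrite eqxx ?orbT.
move=> e'; rewrite !inE => /andP[e'e e'P] ie'.
have [z iz Ez] : exists2 z, incident id z e' & glue h w z = glue h w x.
  by case/orP: ie' => /eqP Ez; [exists (edge_src e')|exists (edge_tgt e')];
    rewrite // /incident eqxx ?orbT.
have [zz0|zab] := fib z Ez; first by apply: U => //; rewrite -zz0.
by rewrite (incz e' z iz e'P zab) eqxx in e'e.
Qed.

(** The edge removed is the one that [lift_matching] puts back, which prefers [cut_last]. *)
Definition band_fan (j : nat) : {fset edge S} :=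
  (fan_matching j `\ (if (j < n)%N then high_edge (size w) else low_edge 0))%fset.

Let outer_last : (outer (size w) == outer 0) = false.
Proof. by rewrite (inj_eq outer_inj) eqn0Ngt w_gt0. Qed.

Let spine_outer j i : (spine j == outer i) = false.
Proof. by rewrite eq_sym (negPf (outer_spine _ _)). Qed.

Let spine_last : (spine n.+1 == spine 0) = false.
Proof. by rewrite (inj_eq spine_inj). Qed.

Lemma glue_spine0 z : (glue h w z == spine 0) = (z \in [:: spine 0; outer (size w)]).
Proof.
rewrite glueE !inE; case: (eqVneq z (outer (size w))) => [->|_].
  by rewrite eqxx orbT.
case: (eqVneq z (spine n.+1)) => [->|_]; last by rewrite orbF.
by rewrite spine_last (negPf (outer_spine _ _)).
Qed.

Lemma glue_outer0 z : (glue h w z == outer 0) = (z \in [:: outer 0; spine n.+1]).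
Proof.
rewrite glueE !inE; case: (eqVneq z (outer (size w))) => [->|_].
  by rewrite spine_outer outer_last (negPf (outer_spine _ _)).
by case: (eqVneq z (spine n.+1)) => [->|_]; rewrite ?eqxx ?orbT // orbF.
Qed.

Lemma glue_id z : z != outer (size w) -> z != spine n.+1 -> glue h w z = z.
Proof. by rewrite glueE => /negPf-> /negPf->. Qed.

Lemma band_fan_matching j : (j <= n)%N -> band_matching h w (band_fan j).
Proof.
move=> le_j; have Pj := fan_matchingP le_j; rewrite /band_fan.
have cs k : (k <= n.+1)%N -> covered id (fan_matching j) (spine k).
  exact: fan_matching_covers_spine.
have co k : (k < n)%N -> covered id (fan_matching j) (outer k).
  exact: fan_matching_covers_outer.
case: ltnP => [lt_j|ge_j].
  apply: (@cut_edge_matching _ _ (outer (size w)) (spine n.+1) (spine 0) (outer 0)) => //.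
  - by rewrite high_fan_matching //= -ltnS lt_j /=.
  - exact: high_edge_tgt.
  - by rewrite !inE eqxx.
  - by rewrite !inE spine_outer eq_sym spine_last.
  - by rewrite !inE eq_sym outer_last (negPf (outer_spine _ _)).
  - exact: cs.
  - exact: co.
  - by move=> z; rewrite glue_spine0 !inE orbC.
  - by move=> z; rewrite glue_outer0 !inE orbC.
  - by move=> z; rewrite !inE !negb_or => /and4P[z1 _ z2 _]; apply: glue_id.
apply: (@cut_edge_matching _ _ (spine 0) (outer 0) (outer (size w)) (spine n.+1)) => //.
- by rewrite low_fan_matching (leq_trans _ ge_j).
- by rewrite in_fsetD1 high_fan_matching // negb_and orbC negb_and -!ltnNge ge_j.
- by rewrite !inE outer_last (negPf (outer_spine _ _)).
- by rewrite !inE spine_outer spine_last.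
- exact: co.
- exact: cs.
- exact: glue_spine0.
- exact: glue_outer0.
- by move=> z; rewrite !inE !negb_or => /and4P[_ z1 _ z2]; apply: glue_id.
Qed.

Let size_lt j : (j <= n)%N -> (j <= size w < n)%N = (j < n)%N.
Proof. by rewrite ltnSn andbT ltnS. Qed.

Lemma band_fan_cut j : (j <= n)%N ->
  ((if (j < n)%N then high_edge (size w) else low_edge 0) |` band_fan j)%fset
  = fan_matching j.
Proof.
move=> le_j; apply: fsetD1K; case: ltnP => [lt_j|ge_j].
  by rewrite high_fan_matching // size_lt.
by rewrite low_fan_matching (leq_trans _ ge_j).
Qed.

Lemma good_matchingP P :
  reflect (exists2 j, (j <= n)%N & P = band_fan j) (good_matching h w P).
Proof.
apply: (iffP andP) => [[bP sP]|[j le_j ->]]; last first.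
  split; first exact: band_fan_matching.
  rewrite cut_lastE cut_firstE; have := band_fan_cut le_j.
  by case: ifP => _ ->; rewrite fan_matchingP // orbT.
have [PE cov] := perfect_matchingP _ _ _ bP.
have hP : high_edge (size w) \notin P.
  by apply/negP => /(fsubsetP PE); rewrite band_edgesE !inE eqxx.
rewrite cut_lastE cut_firstE in sP.
have [/snake_matchingP[j le_j Ej]|nsP] :=
    boolP (snake_matching h w (high_edge (size w) |` P)%fset).
  have lt_j : (j < n)%N.
    by rewrite -(size_lt le_j) -(high_fan_matching _ le_j) -Ej in_fset1U eqxx.
  by exists j => //; rewrite /band_fan lt_j -Ej fsetU1K.
rewrite (negPf nsP) /= in sP; have [j le_j Ej] := snake_matchingP sP.
have jn : j = n.
  apply/eqP; rewrite eqn_leq le_j leqNgt -(size_lt le_j) -(high_fan_matching _ le_j) -Ej.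
  by rewrite in_fset1U eq_edgeE (negPf hP).
exists n => //; rewrite /band_fan ltnn -jn -Ej fsetU1K //.
(* Otherwise [low_edge 0] and [spine_edge n] would both be in [P], although they meet at the vertex
   [outer 0] after gluing. *)
apply/negP => lP; have EP : P = fan_matching n.
  by rewrite -jn -Ej; apply/fsetP => e; rewrite in_fset1U; case: eqP => // ->.
have c0 : covered (glue h w) P (outer 0).
  have /cov[_] : low_edge 0 \in band_edges h w.
    by rewrite band_edgesE !inE eq_edgeE low_snake.
  rewrite low_edge_tgt glue_id //; last by rewrite (outer_spine).
  by rewrite eq_sym outer_last.
have sPn : spine_edge n \in P by rewrite EP spine_fan_matching.
have i1 : incident (glue h w) (outer 0) (low_edge 0).
  by rewrite /incident low_edge_tgt !glue_outer0 mem_head orbT.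
have i2 : incident (glue h w) (outer 0) (spine_edge n).
  by rewrite /incident spine_edge_tgt !glue_outer0 [spine n.+1 \in _]in_cons mem_head !orbT.
by have /eqP := covered_uniq c0 lP i1 sPn i2; rewrite eq_edgeE.
Qed.

Lemma lift_band_fan j : (j <= n)%N -> lift_matching h w (band_fan j) = fan_matching j.
Proof.
move=> le_j; rewrite /lift_matching cut_lastE cut_firstE; have := band_fan_cut le_j.
case: ltnP => [lt_j|ge_j] Ej; first by rewrite Ej fan_matchingP.
have jn : j = n by apply/eqP; rewrite eqn_leq le_j.
case: ifP => // /snake_matchingP[k le_k Ek].
have lt_k : (k < n)%N.
  by rewrite -(size_lt le_k) -(high_fan_matching _ le_k) -Ek in_fset1U eqxx.
have : spine_edge k \in fan_matching k by rewrite spine_fan_matching.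
rewrite -Ek in_fset1U in_fsetD1 eq_edgeE spine_fan_matching jn => /andP[_ /eqP kn].
by rewrite kn ltnn in lt_k.
Qed.

Lemma spine_fan_tile k i : (i < n)%N ->
  (spine_edge k \in tile_edges (fan_tile i)) = (k == i) || (k == i.+1).
Proof. by move=> lt_i; rewrite fan_tileE // !(in_fsetU, in_fset1) !eq_edgeE !orbF. Qed.

Lemma low_fan_tile k i : (i < n)%N -> (low_edge k \in tile_edges (fan_tile i)) = (k == i).
Proof. by move=> lt_i; rewrite fan_tileE // !(in_fsetU, in_fset1) !eq_edgeE !orbF. Qed.

Lemma high_fan_tile k i : (i < n)%N -> (high_edge k \in tile_edges (fan_tile i)) = (k == i).
Proof. by move=> lt_i; rewrite fan_tileE // !(in_fsetU, in_fset1) !eq_edgeE !orbF. Qed.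

Lemma boundary_count e (q : pred nat) :
  (forall i, (i < n)%N -> (e \in tile_edges (fan_tile i)) = q i) ->
  is_boundary_edge h w e = (count q (iota 0 n) == 1%N).
Proof.
move=> eq_q; rewrite /is_boundary_edge snake_tilesE count_map; congr (_ == _).
by apply: eq_in_count => i; rewrite mem_iota add0n => /andP[_ /eq_q].
Qed.

Lemma count_iota1 k : (k < n)%N -> count (eq_op^~ k) (iota 0 n) = 1%N.
Proof. by move=> lt_k; rewrite count_uniq_mem ?iota_uniq // mem_iota add0n lt_k. Qed.

Lemma boundary_spine_edge k : (0 < k < n)%N -> ~~ is_boundary_edge h w (spine_edge k).
Proof.
case: k => // k /andP[_ lt_k]; rewrite (boundary_count (q := predU (eq_op^~ k.+1) (eq_op^~ k))).
  have := count_predUI (eq_op^~ k.+1) (eq_op^~ k) (iota 0 n).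
  rewrite !count_iota1 // 1?ltnW // => E; apply: contra_eqN E => /eqP->.
  rewrite (@eq_count _ _ pred0) ?count_pred0 // => i /=.
  by apply/negbTE/negP => /andP[/eqP-> /eqP/esym/n_Sn].
by move=> i lt_i; rewrite spine_fan_tile // eqSS [k == i]eq_sym eq_sym.
Qed.

Lemma boundary_fan_last e : e \in fan_matching n -> is_boundary_edge h w e.
Proof.
have one k q : (k < n)%N -> (forall i, (i < n)%N -> q i = (i == k)) ->
    count q (iota 0 n) == 1%N.
  move=> lt_k Eq; rewrite -(count_iota1 lt_k); apply/eqP/eq_in_count => i.
  by rewrite mem_iota add0n => /andP[_ /Eq].
move=> eP; have /in_snake fe : e \in E by apply: fsubsetP eP; apply: fan_matching_sub.
case: fe eP => k lt_k; rewrite in_fan_matching //; [move=> /eqP kn|move=> lt_kn|case/andP=> le_k _].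
- rewrite (boundary_count (fun i => @spine_fan_tile k i)) kn.
  apply: (one (size w)) => // i lt_i; rewrite eqSS [size w == i]eq_sym.
  by rewrite [n == i]eq_sym (ltn_eqF lt_i).
- by rewrite (boundary_count (fun i => @low_fan_tile k i)); apply: (one k) => // i _; rewrite eq_sym.
- by rewrite ltnNge le_k in lt_k.
Qed.

Lemma first_tileW : tileW (first_tile h w) = spine_edge 0.
Proof. by rewrite first_tileE. Qed.

Lemma first_tileEast : tileE (first_tile h w) = high_edge 0.
Proof. by rewrite first_tileE. Qed.

(** A spine edge lies on the boundary of the snake graph only for [j = 0] and [j = n], and
    [spine_edge 0] is the forbidden west edge of the first tile. *)
Lemma minimal_matchingE : minimal_matching h w = fan_matching n.
Proof.
have minP P : is_minimal_matching h w P = (P == fan_matching n).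
  rewrite /is_minimal_matching first_tileW first_tileEast.
  apply/and4P/eqP => [[/snake_matchingP[j le_j ->] /allP bd W _]|->].
    have sj : spine_edge j \in fan_matching j by rewrite spine_fan_matching.
    rewrite spine_fan_matching eq_sym in W; congr fan_matching.
    apply/eqP; rewrite eqn_leq le_j leqNgt; apply/negP => lt_j.
    by have := bd _ sj; apply/negP/boundary_spine_edge; rewrite lt0n W.
  split; first exact: fan_matchingP.
  - by apply/allP => e; apply: boundary_fan_last.
  - by rewrite spine_fan_matching.
  - by rewrite high_fan_matching.
rewrite /minimal_matching (eq_filter minP).
have : fan_matching n \in [seq P <- enum_fset (fpowerset E) | P == fan_matching n].
  by rewrite mem_filter eqxx /= fpowersetE fan_matching_sub.
case Es: [seq P <- _ | _] => [//|P s] _ /=.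
by have := mem_head P s; rewrite -Es mem_filter => /andP[/eqP].
Qed.

Lemma nth_tileE i : (i < n)%N -> nth_tile h w i = fan_tile i.
Proof.
move=> lt_i; rewrite /nth_tile snake_tilesE (nth_map 0%N) ?size_iota //.
by rewrite nth_iota.
Qed.

Lemma odd_card_at m (J : {set 'I_m}) (i : 'I_m) :
  odd #|[set k in J | i == k :> nat]| = (i \in J).
Proof.
have -> : [set k in J | i == k :> nat] = if i \in J then [set i] else set0.
  apply/setP => k; rewrite inE [i == k :> nat]eq_sym.
  case: (eqVneq k i) => [->|ki]; first by rewrite eqxx andbT; case: ifP; rewrite !inE ?eqxx.
  by rewrite val_eqE (negPf ki) andbF; case: ifP; rewrite !inE ?(negPf ki).
by case: ifP => _; rewrite ?cards1 ?cards0.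
Qed.

Lemma odd_card_above m (j k : nat) :
  odd #|[set i : 'I_m in [set i : 'I_m | (j <= i)%N] | k == i :> nat]| = (j <= k < m)%N.
Proof.
case: (ltnP k m) => [lt_k|ge_k].
  by rewrite (odd_card_at _ (Ordinal lt_k)) inE andbT.
rewrite andbF (_ : [set _ in _ | _] = set0) ?cards0 //.
by apply/setP => i; rewrite !inE eqn_leq [(k <= i)%N]leqNgt (leq_trans (ltn_ord i)) ?andbF.
Qed.

(** As [low_edge i] lies in the tile [i] only, it decides whether [i] is enclosed, whence
    uniqueness; the parities at the other edges then have to be checked. *)
Lemma enclosed_fan j : (j <= n)%N ->
  enclosed_tiles h w (fan_matching j) = [set i : 'I_n | (j <= i)%N].
Proof.
move=> le_j; rewrite /enclosed_tiles minimal_matchingE; set D := fsetU _ _.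
have inD e : (e \in D) = (e \in fan_matching j) (+) (e \in fan_matching n).
  rewrite /D in_fsetU !in_fsetD.
  by case: (e \in fan_matching j); case: (e \in fan_matching n).
have in_nth e (i : 'I_n) : (e \in tile_edges (nth_tile h w i)) = (e \in tile_edges (fan_tile i)).
  by rewrite nth_tileE.
have in_T (J : {set 'I_n}) e :
    (e \in [fset e' in E | odd #|[set i in J | e' \in tile_edges (nth_tile h w i)]|]%fset)
    = (e \in E) && odd #|[set i in J | e \in tile_edges (nth_tile h w i)]|.
  by rewrite !inE.
have in_low k (i : 'I_n) : (low_edge k \in tile_edges (nth_tile h w i)) = (k == i).
  by rewrite in_nth low_fan_tile.
have -> : odflt set0 [pick J : {set 'I_n} |
    [fset e in E | odd #|[set i in J | e \in tile_edges (nth_tile h w i)]|]%fset == D]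
  = odflt set0 [pick J | J == [set i : 'I_n | (j <= i)%N]]; last first.
  by case: pickP => [J /eqP //|/(_ [set i : 'I_n | (j <= i)%N])]; rewrite eqxx.
congr odflt; apply: eq_pick => J; apply/eqP/eqP => [E|->].
  apply/setP => i; rewrite -odd_card_at inE.
  have : (low_edge i \in D) = (j <= i)%N.
    by rewrite inD !low_fan_matching ltn_ord [(i < j)%N]ltnNge addbT negbK.
  rewrite -E in_T low_snake ltn_ord /= => <-; congr (odd #|pred_of_set _|).
  by apply/setP => k; rewrite [LHS]in_set [RHS]in_set in_low.
apply/fsetP => e; rewrite inD in_T.
have [eE|nE] := boolP (e \in E); last first.
  by rewrite (negPf (contraNN (fsubsetP (fan_matching_sub le_j) e) nE))
       (negPf (contraNN (fsubsetP (fan_matching_sub (leqnn n)) e) nE)).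
have card_eq (q : nat -> bool) :
    (forall i : 'I_n, (e \in tile_edges (nth_tile h w i)) = q i) ->
    [set i in [set i : 'I_n | (j <= i)%N] | e \in tile_edges (nth_tile h w i)]
    = [set i in [set i : 'I_n | (j <= i)%N] | q i].
  by move=> Eq; apply/setP => i; rewrite in_set [RHS]in_set Eq.
rewrite andTb; case: (in_snake eE) card_eq => k lt_k card_eq.
- rewrite !in_fan_matching //.
  rewrite (card_eq (fun i => (k == i) || (k == i.+1))); last first.
    by move=> i; rewrite in_nth spine_fan_tile.
  rewrite (_ : [set _ in _ | _] = [set i in [set i : 'I_n | (j <= i)%N] | k == i :> nat]
     :|: [set i in [set i : 'I_n | (j <= i)%N] | k == i.+1 :> nat]); last first.
    by apply/setP => i; rewrite !in_set andb_orr.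
  rewrite cardsU (_ : _ :&: _ = set0) ?cards0 ?subn0; last first.
    apply/setP => i; rewrite !in_set; apply/negbTE/negP => /andP[/andP[_ /eqP->] /andP[_ /eqP]].
    exact/n_Sn.
  rewrite oddD odd_card_above.
  case: k lt_k {card_eq} => [|k] lt_k.
    rewrite (_ : [set _ in _ | _] = set0) ?cards0 /=; last by apply/setP => i; rewrite !in_set andbF.
    by rewrite leqn0 addbF eq_sym andbT addbF.
  rewrite (_ : odd #|[set i in [set i : 'I_n | (j <= i)%N] | k.+1 == i.+1 :> nat]| = (j <= k < n)%N); last first.
    by rewrite -odd_card_above.
  by case: (ltngtP k n) lt_k (le_j); case: (ltngtP j k); lia.
- rewrite !low_fan_matching (card_eq (eq_op k)); last by move=> i; rewrite in_low.
  by rewrite odd_card_above lt_k andbT addbT ltnNge negbK.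
- rewrite !high_fan_matching // (card_eq (eq_op k)); last first.
    by move=> i; rewrite in_nth high_fan_tile.
  by rewrite odd_card_above lt_k [(n <= k)%N]leqNgt lt_k addbF.
Qed.

Lemma band_fan_inj j k : (j <= n)%N -> (k <= n)%N -> band_fan j = band_fan k -> j = k.
Proof.
move=> le_j le_k Ejk; have : spine_edge j \in band_fan j.
  by rewrite in_fsetD1 spine_fan_matching eqxx andbT; case: ifP; rewrite eq_edgeE.
by rewrite Ejk in_fsetD1 spine_fan_matching => /andP[_ /eqP].
Qed.

Lemma fan_matching_uniq j : uniq (spine_edge j :: [seq low_edge i | i <- iota 0 j]
     ++ [seq high_edge i | i <- iota j (n - j)]).
Proof.
rewrite /= cat_uniq mem_cat !map_inj_uniq ?iota_uniq; last 2 first.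
- by move=> i k /eqP; rewrite eq_edgeE => /eqP.
- by move=> i k /eqP; rewrite eq_edgeE => /eqP.
rewrite andbT; apply/and3P; split=> //.
  by rewrite negb_or; apply/andP; split; apply/mapP => -[i _ /eqP]; rewrite eq_edgeE.
by apply/hasPn => _ /mapP[i _ ->]; apply/mapP => -[k _ /eqP]; rewrite eq_edgeE.
Qed.

(** Both copies of the cut edge are labelled by a side of value 1, so the weight can be computed on
    the snake matching. *)
Lemma band_fan_weight (R : comPzRingType) (X : S -> R) j :
  X (ccw (ccw h)) = 1 -> X (ccw (opp (last h w))) = 1 -> (j <= n)%N ->
  \prod_(e <- enum_fset (band_fan j)) X (edge_label e) =
  X (edge_label (spine_edge j)) * (\prod_(0 <= i < j) X (ccw (ccw (H i))) *
                                   \prod_(j <= i < n) X (ccw (opp (H i)))).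
Proof.
move=> X_first X_last le_j.
transitivity (\prod_(e <- fan_matching j) X (edge_label e)); last first.
  have/(perm_big _)-> : perm_eq (fan_matching j) (spine_edge j ::
      [seq low_edge i | i <- iota 0 j] ++ [seq high_edge i | i <- iota j (n - j)]).
    apply: uniq_perm; rewrite ?fset_uniq ?fan_matching_uniq // => e.
    by rewrite /fan_matching in_fset.
  by rewrite big_cons big_cat !big_map /index_iota subn0.
have hi1 : X (edge_label (high_edge (size w))) = 1 by rewrite -X_last last_nthE.
have lo1 : X (edge_label (low_edge 0)) = 1 by rewrite -X_first.
rewrite /band_fan; case: ltnP => cj.
  by rewrite [RHS](big_fsetD1 (high_edge (size w))) ?high_fan_matching ?size_lt // hi1 Monoid.mul1m.
by rewrite [RHS](big_fsetD1 (low_edge 0)) ?low_fan_matching ?(leq_trans _ cj) // lo1 Monoid.mul1m.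
Qed.

Lemma band_formula_fan (F : fieldType) (X Y : S -> F) :
  X (ccw (ccw h)) = 1 -> X (ccw (opp (last h w))) = 1 ->
  band_formula h w X Y = (\prod_(k <- h :: w) X k)^-1 *
    \sum_(j < n.+1) X (edge_label (spine_edge j)) *
      (\prod_(0 <= i < j) X (ccw (ccw (H i))) * \prod_(j <= i < n) X (ccw (opp (H i)))) *
      \prod_(j <= i < n) Y (H i).
Proof.
move=> X_first X_last; rewrite /band_formula; congr (_ * _).
rewrite -big_filter; have /(perm_big _)-> : perm_eq
    [seq P <- enum_fset (fpowerset (band_edges h w)) | good_matching h w P]
    [seq band_fan j | j <- iota 0 n.+1].
  apply: uniq_perm; first by rewrite filter_uniq ?fset_uniq.
    rewrite map_inj_in_uniq ?iota_uniq // => i k.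
    by rewrite !mem_iota !add0n !ltnS => /andP[_ le_i] /andP[_ le_k]; apply: band_fan_inj.
  move=> P; rewrite mem_filter; apply/andP/mapP => [[/good_matchingP[j le_j ->] _]|[j]].
    by exists j => //; rewrite mem_iota.
  rewrite mem_iota add0n ltnS => /andP[_ le_j] ->; split; first by apply/good_matchingP; exists j.
  by rewrite fpowersetE; have /perfect_matchingP[] := band_fan_matching le_j.
rewrite big_map -[iota 0 n.+1]/(index_iota 0 n.+1) big_mkord.
apply: eq_bigr => j _; have le_j : (j <= n)%N by rewrite -ltnS.
rewrite lift_band_fan // enclosed_fan // band_fan_weight //; congr (_ * _).
rewrite (eq_bigl (fun i : 'I_n => (j <= i)%N)); last by move=> i; rewrite in_set.
by rewrite [RHS](big_nat_widenl j 0) // big_mkord.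
Qed.

End FanBand.

(** * The boundary loop and its lift *)

Section BoundaryLoop.

Variable O : orbifold.

Local Notation I := (arc O).
Local Notation vec := {ffun I -> int}.
Local Notation turn := (@turn O).

Variable b : O.
Hypotheses (bdry_b : bdry O = [set b]) (unp : unpunctured O).

Local Notation N := (order turn b).
Local Notation end_ j := (iter j turn b).

Lemma iter_turn_b j : (0 < j < N)%N -> end_ j != b.
Proof.
move=> /andP[j_gt0 lt_N]; apply: contraTneq j_gt0 => Ej.
by rewrite -(rank_iter lt_N) Ej rank_b.
Qed.

Lemma end_last : turn (end_ N.-1) = b.
Proof. by rewrite -iterS prednK ?order_gt0 // (iter_order (@turn_inj O)). Qed.

(** Ensures at least two crossings, hence distinct first and last tiles. *)
Lemma order_ge3 : (2 < N)%N.
Proof.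
have c1 : ccw b != b := ccw_neq b; have c2 : ccw (ccw b) != ccw b := ccw_neq _.
have c3 : ccw (ccw b) != b by apply: contra_neq c2 => E; rewrite -[RHS]ccw3 E.
have u : uniq [:: ccw (ccw b); ccw b; b] by rewrite /= !inE negb_or c2 c3 c1.
rewrite -[3%N]/(size [:: ccw (ccw b); ccw b; b]) -size_orbit.
by apply: uniq_leq_size u _ => h _; rewrite -fconnect_orbit connect_b.
Qed.

Lemma boundary_loopE : boundary_loop b = traject turn (turn b) N.-1.
Proof.
rewrite /boundary_loop /orbit -[in LHS](prednK (order_gt0 turn b)) trajectS /=.
rewrite bdry_b inE eqxx /=; apply/all_filterP/allP => h /trajectP[j lt_j ->].
by rewrite -iterSr inE iter_turn_b //= -[X in (_ < X)%N](prednK (order_gt0 turn b)).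
Qed.

Variables (K : fieldType) (y x : I -> K) (hv : K -> vec -> Prop).
Hypotheses (V : valuation y hv) (val_x : forall i, hv (x i) 0).

Lemma ypow_arc_end h : ypow y [ffun i : I => (h \in val i)%:Z] = side_value y h.
Proof.
have [hb|hb] := boolP (h \in bdry O).
  have /eqP-> : h == b by rewrite bdry_b inE in hb.
  rewrite side_value_b // (_ : [ffun _ => _] = 0) ?ypow0 //.
  by apply/ffunP => i; rewrite !ffunE arc_bdry // bdry_b inE.
have [i hi] := arc_ex hb; rewrite (side_value_arc _ hi) /ypow (bigD1 i) //= ffunE hi expr1z.
rewrite big1 ?mulr1 // => j ji; rewrite ffunE; case: (boolP (h \in val j)) => // hj.
by rewrite (arc_uniq hj hi) eqxx in ji.
Qed.

Lemma ypow_later_ends j : (j < N)%N ->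
  ypow y (later_ends b (end_ j)) = \prod_(j <= i < N.-1) side_value y (end_ i.+1).
Proof.
move=> lt_j; have le_j : (j <= N.-1)%N by rewrite -ltnS prednK ?order_gt0.
rewrite -(subKn le_j); elim: (N.-1 - j)%N (leq_subr j N.-1) => [_|d IHd lt_d].
  by rewrite subn0 big_geq // later_ends_last ?ypow0 // end_last.
have lt' : (N.-1 - d.+1 < N.-1)%N by rewrite ltn_subrL (leq_ltn_trans _ lt_d).
have Ed : (N.-1 - d.+1).+1 = (N.-1 - d)%N by rewrite -subSn // subSS.
rewrite big_ltn // Ed -IHd ?(ltnW lt_d) // later_ends_turn //.
  by rewrite (ypowD V) ypow_arc_end -iterS Ed mulrC.
rewrite -iterS Ed iter_turn_b // subn_gt0 lt_d /=.
by rewrite (leq_ltn_trans (leq_subr _ _)) // prednK ?order_gt0.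
Qed.

Variables (S : orbifold) (p : S -> O) (w' : seq S).
Hypotheses (unf : is_unfolding p) (lift : is_closed_lift p (boundary_loop b) w').

(** The lift is a fan, and its good matching [j] gives the corner between [end_ j] and [end_ j.+1]
    once the variables of the other ends cancel. *)
Lemma boundary_loop_expansion :
  band_expansion (fun h => side_value x (p h)) (fun h => side_value y (p h)) w'
  = corner_sum b y x N.
Proof.
have [_ p_ccw p_opp _] := unf; have [/and3P[_ _ cyc] Ew'] := lift.
have opp_b := opp_b bdry_b.
rewrite boundary_loopE in Ew'; have N3 := order_ge3.
have NE : N = N.-1.+1 by rewrite prednK ?order_gt0.
case: w' cyc Ew' => [|h w] cyc Ew'.
  by move/(congr1 size): Ew'; rewrite size_traject => E; rewrite NE -E in N3.
have sz : (size w).+1 = N.-1 by rewrite -[N.-1](size_traject turn (turn b)) -Ew' size_map.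
have w_gt0 : (0 < size w)%N by rewrite -ltnS sz -ltnS -NE.
set H := nth h (h :: w).
have pH i : (i <= size w)%N -> p (H i) = end_ i.+1.
  move=> lt_i; rewrite /H -(@nth_map _ h _ (turn b) p i (h :: w) lt_i) Ew'.
  by rewrite nth_traject -?sz ?ltnS // -iterSr.
(* The two possible continuations upstairs have different images, so the turns of the lift are read
   off below. *)
have p_step h' g : crossing_step g h' -> p h' = turn (p g) -> h' = ccw (opp g).
  case/orP => /eqP-> //; rewrite !p_ccw p_opp => /eqP.
  by rewrite (negPf (ccw_neq _)).
have fan_w i : (i < size w)%N -> H i.+1 = ccw (opp (H i)).
  move=> lt_i; apply: p_step; last by rewrite (pH i.+1 lt_i) (pH i (ltnW lt_i)).
  have lt_r : (i < size (rcons w h))%N by rewrite size_rcons ltnW.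
  have := pathP h cyc i lt_r; rewrite -rcons_cons !nth_rcons lt_i.
  by rewrite [(i < size (h :: w))%N]ltnW.
have p_last : p (last h w) = end_ N.-1.
  by rewrite (last_nth h) -/(H _) pH // sz.
(* The closing step crosses the triangle of the boundary side and must skip that side, hence the
   other turn. *)
have fan_h : h = ccw (ccw (opp (last h w))).
  have /= : crossing_step (last h w) h.
    by move: cyc => /=; rewrite rcons_path => /andP[].
  case/orP => /eqP Eh //; have := pH 0%N isT; rewrite /H /= {1}Eh p_ccw p_opp.
  rewrite p_last -[ccw _]/(turn _) end_last /Defs.turn opp_b => /eqP.
  by rewrite eq_sym (negPf (ccw_neq b)).
have sx0 z : side_value x z != 0 by apply: (hv_neq0 V (val_side bdry_b V val_x z)).
rewrite /= (band_formula_fan fan_w fan_h w_gt0); first last.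
- by rewrite p_ccw p_opp p_last -[ccw _]/(turn _) end_last side_value_b.
- by rewrite !p_ccw (pH 0%N isT) /= /Defs.turn opp_b ccw3 side_value_b.
rewrite sz -NE /corner_sum big_distrr; apply: eq_bigr => j _.
have lt_j := ltn_ord j; have le_j : (j <= N.-1)%N by rewrite -ltnS -NE.
rewrite /= /corner ypow_later_ends //.
(* Both occurrences of [b], of value 1, are added at the bounds [0] and [N], so that only the
   factors [j] and [j.+1] survive uniformly in [j]. *)
have -> : \prod_(k <- h :: w) side_value x (p k) = \prod_(0 <= i < N.-1.+2) side_value x (end_ i).
  rewrite big_nat_recl // big_nat_recr //= end_last.
  rewrite side_value_b // mul1r mulr1.
  rewrite (big_nth h) [size (h :: w)]sz !big_nat; apply: eq_bigr => i /andP[_ lt_i].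
  by rewrite pH // -ltnS sz.
have -> : \prod_(0 <= i < j) side_value x (p (ccw (ccw (H i))))
    = \prod_(0 <= i < j) side_value x (end_ i).
  rewrite !big_nat; apply: eq_bigr => i /andP[_ lt_i].
  rewrite !p_ccw pH; last by rewrite -ltnS sz (leq_trans lt_i).
  by rewrite iterS /Defs.turn ccw3 side_value_opp.
have -> : \prod_(j <= i < N.-1) side_value x (p (ccw (opp (H i))))
    = \prod_(j.+2 <= i < N.-1.+2) side_value x (end_ i).
  rewrite !big_add1 /= !big_nat; apply: eq_bigr => i /andP[_ lt_i].
  by rewrite p_ccw p_opp pH // -ltnS sz.
have -> : \prod_(j <= i < N.-1) side_value y (p (H i))
    = \prod_(j <= i < N.-1) side_value y (end_ i.+1).
  rewrite !big_nat; apply: eq_bigr => i /andP[_ lt_i].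
  by rewrite pH // -ltnS sz.
have -> : side_value x (p (edge_label (spine_edge h w j))) = side_value x (ccw (turn (end_ j))).
  rewrite /spine_edge /edge_label sz /=; case: ltnP => [lt|ge].
    by rewrite p_ccw pH // -ltnS sz.
  have -> : nat_of_ord j = N.-1 by apply/eqP; rewrite eqn_leq le_j ge.
  by rewrite -[X in X.-1]sz succnK -last_nth !p_ccw p_opp p_last.
rewrite (@big_cat_nat _ _ _ j 0) //=; last by rewrite ltnW // ltnW // ltnS.
rewrite (@big_ltn _ _ _ j) ?(@big_ltn _ _ _ j.+1) //; last by rewrite ltnW // ltnS.
set A := \prod_(0 <= i < j) _; set B := \prod_(j.+2 <= i < _) _.
have A0 : A != 0 by rewrite prodf_seq_neq0; apply/allP => i _; apply/implyP.
have B0 : B != 0 by rewrite prodf_seq_neq0; apply/allP => i _; apply/implyP.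
set Z := \prod_(j <= i < _) _.
by have := sx0 (end_ j); have := sx0 (turn (end_ j)); rewrite -iterS => s1 s2; field; rewrite s1 s2 A0 B0.
Qed.

End BoundaryLoop.

Theorem theorem4p1 (O : orbifold) (O_unpunctured : unpunctured O)
    (O_one_marked_point : nb_marked_points O = 1%N)
    (b : O) (b_bdry : b \in bdry O)
    (f : ambient_field O) (f_loop : is_laurent_polynomial_of (boundary_loop b) f) :
  orbifold_cluster_algebra f.
Proof.
have bdry_b : bdry O = [set b].
  apply/eqP; rewrite eq_sym eqEcard sub1set b_bdry cards1.
  by rewrite -[#|_|]/(nb_marked_points O) O_one_marked_point.
have [S [p [w' [unf lift ->]]]] := f_loop.
have V := has_val_valuation O.
have val_x (i : arc O) : has_val (xvar i) 0 by apply: has_val_xvar.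
rewrite -[specialized_expansion _ _]/(band_expansion (fun h => side_value (@xvar O) (p h))
  (fun h => side_value (@yvar O) (p h)) w').
rewrite (boundary_loop_expansion bdry_b O_unpunctured V val_x unf lift).
exact (corner_sum_cluster_algebra bdry_b O_unpunctured V val_x).
Qed.
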